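(* Let $\varkappa$ be a positive integer. Assume that $T$ is a subset of $\mathbb Z^\varkappa$ such that $0\in T=-T$, and $Y\subset\mathbb T^\varkappa$ is a determining set for $\mathcal P_+(\mathbb T^\varkappa)$. If $\{c_\alpha\}_{\alpha\in T}$ is a sequence of complex numbers, then the following conditions are equivalent: (i) there exists a finite positive Borel measure $\mu$ on $\mathbb T^\varkappa$ such that $c_\alpha=\int_{\mathbb T^\varkappa}z^\alpha\,d\mu(z)$ for all $\alpha\in T$; (ii) $\sum_{\alpha\in T}a_\alpha c_\alpha\ge0$ for every finite system $\{a_\alpha\}_{\alpha\in T}$ of complex numbers such that $\sum_{\alpha\in T}a_\alpha z^\alpha\ge0$ for all $z\in\mathbb T^\varkappa$; (iii) $\sum_{\alpha\in T}a_\alpha c_\alpha\ge0$ for every finite system $\{a_\alpha\}_{\alpha\in T}$ of complex numbers for which there exist finitely many analytic trigonometric polynomials $q_1,\dots,q_k\in\mathcal P_+(\mathbb T^\varkappa)$ such that $\sum_{\alpha\in T}a_\alpha z^\alpha=\sum_{j=1}^k|q_j(z)|^2$ for all $z\in Y$.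
   Context: $\mathbb T=\{z\in\mathbb C\colon|z|=1\}$, $\mathbb Z_+=\{0,1,2,\dots\}$; $0$ also denotes the zero element of $\mathbb Z^\varkappa$. For $z\in\mathbb T^\varkappa$ and $\alpha\in\mathbb Z^\varkappa$, $z^\alpha=z_1^{\alpha_1}\cdots z_\varkappa^{\alpha_\varkappa}$. A system of complex numbers is finite if only finitely many members are nonzero. $\mathcal P_+(\mathbb T^\varkappa)$ (analytic trigonometric polynomials) is the set of all functions $p\colon\mathbb T^\varkappa\to\mathbb C$ of the form $p(z)=\sum_{\alpha\in\mathbb Z_+^\varkappa}a_\alpha z^\alpha$ with $\{a_\alpha\}$ a finite system of complex numbers. A nonempty $Y\subset\mathbb T^\varkappa$ is determining for $\mathcal P_+(\mathbb T^\varkappa)$ if each $p\in\mathcal P_+(\mathbb T^\varkappa)$ vanishing on $Y$ vanishes on $\mathbb T^\varkappa$. *)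

(* Defs.v *)
From HB Require Import structures.
From mathcomp Require Import all_boot all_order all_algebra.
From mathcomp Require Import complex.
From mathcomp Require Import all_classical all_reals all_analysis.
Set Implicit Arguments.
Unset Strict Implicit.
Unset Printing Implicit Defensive.
Import Order.TTheory GRing.Theory Num.Theory.
Import numFieldNormedType.Exports.
Local Open Scope classical_set_scope.
Local Open Scope complex_scope.
Local Open Scope ring_scope.

(* R[i]^o is R[i] seen with the topology of its norm. *)
Definition torus_set (R : realType) (k : nat) : set 'rV[R[i]^o]_k :=
  [set z | forall j, `|z 0 j| = 1].
Arguments torus_set R k : clear implicits.

(* The subset T^k of C^k as a type, with the subspace topology. *)
Definition torus (R : realType) (k : nat) : Type :=
  set_type (torus_set R k).

HB.instance Definition _ (R : realType) (k : nat) :=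
  Topological.copy (torus R k)
    (set_type (torus_set R k)).

Lemma torus_const1 (R : realType) (k : nat) :
  (const_mx 1 : 'rV[R[i]^o]_k) \in torus_set R k.
Proof. by rewrite inE /= => j; rewrite mxE normr1. Qed.

Definition torus_one (R : realType) (k : nat) : torus R k :=
  exist (fun z => z \in torus_set R k) (const_mx 1) (torus_const1 R k).

(* Measurable types are required to be pointed. *)
HB.instance Definition _ (R : realType) (k : nat) :=
  isPointed.Build (torus R k) (torus_one R k).

(* T^k with its Borel sigma-algebra. *)
Notation borel_torus R k := (g_sigma_algebraType (@open (torus R k))).

Definition coordinate (R : realType) (k : nat) (z : torus R k) (j : 'I_k)
  : R[i] := (\val z : 'rV[R[i]^o]_k) 0 j.

Definition monomial (R : realType) (k : nat) (al : 'rV[int]_k) (z : torus R k)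
  : R[i] := \prod_(j < k) coordinate z j ^ al 0 j.

(* A system (a_al)_{al in T} is encoded by a total function on Z^k,
   of which only the values on T matter. *)
Definition finite_system (R : realType) (k : nat) (T : set 'rV[int]_k)
  (a : 'rV[int]_k -> R[i]) : Prop :=
  finite_set [set al | T al /\ a al != 0].

Definition trig_sum (R : realType) (k : nat) (T : set 'rV[int]_k)
  (a : 'rV[int]_k -> R[i]) (z : torus R k) : R[i] :=
  \sum_(al \in T) a al * monomial al z.

Definition nonneg_index (k : nat) : set 'rV[int]_k :=
  [set al | forall j, 0 <= al 0 j].
Arguments nonneg_index k : clear implicits.

Definition analytic_trig_poly (R : realType) (k : nat)
  : set (torus R k -> R[i]) :=
  [set p | exists a : 'rV[int]_k -> R[i],
     finite_system (nonneg_index k) a /\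
     forall z, p z = trig_sum (nonneg_index k) a z].

Definition determining (R : realType) (k : nat) (Y : set (torus R k)) : Prop :=
  Y !=set0 /\
  forall p, analytic_trig_poly p ->
    (forall z, Y z -> p z = 0) -> forall z, p z = 0.

(* Meaningful when both parts of f are integrable, e.g. for a monomial
   against a finite Borel measure. *)
Definition complex_integral (d : measure_display) (X : measurableType d)
  (R : realType) (mu : {measure set X -> \bar R}) (f : X -> R[i]) : R[i] :=
  (\int[mu]_x complex.Re (f x)) +i* (\int[mu]_x complex.Im (f x)).

(* Main.v *)
Require Import Defs.
From HB Require Import structures.
From mathcomp Require Import all_boot all_order all_algebra all_solvable all_field.
From mathcomp Require Import complex.
From mathcomp Require Import all_classical all_reals all_analysis.
From mathcomp Require Import finmap ring lra zify.
Set Implicit Arguments.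
Unset Strict Implicit.
Unset Printing Implicit Defensive.
Import Order.TTheory GRing.Theory Num.Theory.
Import numFieldNormedType.Exports.
Local Open Scope classical_set_scope.
Local Open Scope complex_scope.
Local Open Scope ring_scope.

(* Between the moments and positivity on the torus, the substance is a Riesz
   representation: positivity on the torus makes a_al |-> sum a_al c_al a
   well-defined positive functional on the real trigonometric polynomials with
   exponents in T. M. Riesz's extension theorem extends it to a positive
   functional L on all bounded functions, and A |-> L(1_A) is a finitely additive
   content m. The outer measure generated by the values of m on open sets
   satisfies mu(U) <= m(U) for open U, with equality for the whole torus by
   compactness; summing over superlevel sets gives int f dmu <= L(f) for
   continuous f >= 0, hence equality, as the same holds for 1 - f.

   Between positivity on the torus and on sums of squares over Y: an identity
   p = sum |q_j|^2 on Y becomes, after multiplication by a monomial, the vanishing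
   on Y of an analytic polynomial, so it holds on the whole torus. Conversely, if
   p >= 0 then p + e is a sum of squares for every e > 0: it is the Fejer mean of
   a polynomial h with Re h >= 0, and computing that mean as an average over a
   grid of roots of unity writes it as a positive combination of the squares
   |D_w(z)|^2 of analytic Dirichlet kernels. *)

(** * Positive extension of functionals *)

Section positive_extension.
Context {R : realType} {X : Type}.
Implicit Types (f g : X -> R) (G H : set ((X -> R) * R)) (r s t : R).

(* A functional on a subspace is represented by its graph; positivity makes a
   linear graph single-valued. *)
Definition linear_graph G :=
  forall t p q, G p -> G q -> G (fun x => t * p.1 x + q.1 x, t * p.2 + q.2).

Definition positive_graph G :=
  forall p, G p -> (forall x, 0 <= p.1 x) -> 0 <= p.2.

Definition real_bounded f := exists B, forall x, `|f x| <= B.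

Lemma linear_graph0 G p : linear_graph G -> G p -> G (fun=> 0, 0).
Proof.
move=> Glin Gp; have := Glin (-1) p p Gp Gp; rewrite mulN1r addNr.
by congr G; congr pair; apply/funext => x; rewrite mulN1r addNr.
Qed.

Lemma linear_graphZ G t p : linear_graph G -> G p ->
  G (fun x => t * p.1 x, t * p.2).
Proof.
move=> Glin Gp; have := Glin t _ _ Gp (linear_graph0 Glin Gp); rewrite /= addr0.
by congr G; congr pair; apply/funext => x; rewrite addr0.
Qed.

Lemma positive_graph_le G p q : linear_graph G -> positive_graph G ->
  G p -> G q -> (forall x, p.1 x <= q.1 x) -> p.2 <= q.2.
Proof.
move=> Glin Gpos Gp Gq pq; rewrite -subr_ge0.
have := Gpos _ (Glin (-1) p q Gp Gq); rewrite /= mulN1r addrC; apply.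
by move=> x; rewrite mulN1r addrC subr_ge0.
Qed.

(** Zorn's lemma: the domain of a maximal graph contains every bounded function, since at a missing
    one a value between those forced by its minorants and majorants could be adjoined. *)
Lemma maximal_positive_graph G c : linear_graph G -> positive_graph G ->
  G (fun=> 1, c) ->
  exists H, [/\ linear_graph H, positive_graph H, G `<=` H &
    forall f, real_bounded f -> exists r, H (f, r)].
Proof.
move=> Glin Gpos G1.
(* The conditions bear on the union of [G] and [H], so that the empty chain, whose union is empty,
   satisfies them. *)
pose P := [set H | [/\ linear_graph (G `|` H) & positive_graph (G `|` H)]].
have [F FP Ftot|H [[Hlin Hpos] Hmax]] := @Zorn_bigcup _ P.
  have GU p : (G `|` \bigcup_(X in F) X) p -> G p \/ exists2 H, F H & H p.
    by move=> [Gp|[H FH Hp]]; [left|right; exists H].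
  split.
  - move=> t p q /GU[Gp|[H FH Hp]] /GU[Gq|[K FK Kq]].
    + by left; exact: Glin.
    + have [Klin _] := FP _ FK.
      by case: (Klin t p q (or_introl Gp) (or_intror Kq)) => ?;
        [left|right; exists K].
    + have [Klin _] := FP _ FH.
      by case: (Klin t p q (or_intror Hp) (or_introl Gq)) => ?;
        [left|right; exists H].
    + have [HK|KH] := Ftot _ _ FH FK.
      * have [Klin _] := FP _ FK.
        by case: (Klin t p q (or_intror (HK _ Hp)) (or_intror Kq)) => ?;
          [left|right; exists K].
      * have [Klin _] := FP _ FH.
        by case: (Klin t p q (or_intror Hp) (or_intror (KH _ Kq))) => ?;
          [left|right; exists H].
  - move=> p /GU[Gp|[H FH Hp]]; first exact: Gpos.
    by have [_ +] := FP _ FH; apply; right.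
exists (G `|` H); split => //.
move=> f [B fB].
set K := G `|` H in Hlin Hpos *.
have K1 t : K (fun=> t, t * c).
  have := linear_graphZ t Hlin (or_introl G1 : K _).
  by congr K; congr pair; apply/funext => x; rewrite mulr1.
pose S := [set r | exists2 g, K (g, r) & forall x, g x <= f x].
have S0 : S (- B * c).
  by exists (fun=> - B) => // x; have := fB x; rewrite ler_norml => /andP[].
have Sub g r : K (g, r) -> (forall x, f x <= g x) -> ubound S r.
  move=> Kg fg s [h Kh hf]; apply: (positive_graph_le Hlin Hpos Kh Kg) => x /=.
  exact: le_trans (hf x) (fg x).
have supS : has_sup S.
  split; first by exists (- B * c).
  exists (B * c); apply: Sub (K1 B) _ => x.
  by have := fB x; rewrite ler_norml => /andP[].
(* Any value between sup S and the infimum over majorants of f would do. *)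
pose s := sup S.
pose K' := [set p | exists q t, [/\ K q, p.1 = (fun x => q.1 x + t * f x) &
  p.2 = q.2 + t * s]].
have KK' : K `<=` K'.
  move=> p Kp; exists p, 0; split => //; last by rewrite mul0r addr0.
  by apply/funext => x; rewrite mul0r addr0.
exists s; apply: contrapT => nKfs.
(* [K'] is the span of [K] and [(f, s)]. It lies strictly above [H] because it contains [(f, s)]; it
   remains to see that it is linear and positive. *)
apply: (Hmax K').
  split; last by move=> /(_ (f, s)) H'; apply: nKfs; right; apply: H';
    exists (fun=> 0, 0), 1; split; rewrite ?mul1r ?add0r//;
    [exact: linear_graph0 Hlin (K1 1)|apply/funext => x; rewrite mul1r add0r].
  by move=> p Hp; apply: KK'; right.
have GK' : G `|` K' = K'.
  by apply/seteqP; split=> [p [Gp|//]|p]; [apply: KK'; left|right].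
rewrite /P /= GK'; split.
- move=> t p q [p1 [tp [Kp1 -> ->]]] [q1 [tq [Kq1 -> ->]]] /=.
  exists (fun x => t * p1.1 x + q1.1 x, t * p1.2 + q1.2), (t * tp + tq).
  split => /=; [exact: Hlin|by apply/funext => x; ring|by ring].
- move=> p [q [t [Kq -> ->]]] /= pos.
  (* If t < 0, then q / (-t) majorizes f, so its value bounds [S] and hence s. If t > 0, then -q / t
     minorizes f, so its value is at most s. *)
  have [t0|t0|t0] := ltgtP t 0.
  + rewrite -[t]opprK mulNr subr_ge0 mulrC -ler_pdivlMr ?oppr_gt0//.
    apply: ge_sup; first by exists (- B * c).
    rewrite mulrC; apply: (Sub (fun x => (- t)^-1 * q.1 x)).
      exact: linear_graphZ.
    move=> x; rewrite mulrC ler_pdivlMr ?oppr_gt0//.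
    by have := pos x; rewrite mulrN mulrC; lra.
  + rewrite -lerBlDl sub0r mulrC -ler_pdivrMr//.
    apply: sup_upper_bound => //.
    exists (fun x => - t^-1 * q.1 x).
      by have := linear_graphZ (- t^-1) Hlin Kq; congr K; congr pair; ring.
    move=> x; rewrite mulNr mulrC -mulNr ler_pdivrMr//.
    by have := pos x; rewrite mulrC; lra.
  + by rewrite t0 mul0r addr0; apply: Hpos => // x; have := pos x;
      rewrite t0 mul0r addr0.
Qed.

(* M. Riesz's extension theorem, for the cone of nonnegative functions. *)
Lemma positive_extension G c : linear_graph G -> positive_graph G ->
  G (fun=> 1, c) ->
  exists L : (X -> R) -> R, [/\
    forall f r, real_bounded f -> G (f, r) -> L f = r,
    forall t f g, real_bounded f -> real_bounded g ->
      L (fun x => t * f x + g x) = t * L f + L g &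
    forall f, real_bounded f -> (forall x, 0 <= f x) -> 0 <= L f].
Proof.
move=> Glin Gpos G1.
have [H [Hlin Hpos GH Hdom]] := maximal_positive_graph Glin Gpos G1.
(* The default 0 can occur only at unbounded functions. *)
pose L f := xget 0 [set r | H (f, r)].
have HL f : real_bounded f -> H (f, L f).
  by move=> /Hdom[r Hr]; rewrite /L; case: xgetP => [y _ //|/(_ r)].
have Huniq f r s : H (f, r) -> H (f, s) -> r = s.
  move=> Hr Hs; apply/eqP; rewrite eq_le.
  by rewrite (positive_graph_le Hlin Hpos Hr Hs)//
    (positive_graph_le Hlin Hpos Hs Hr).
exists L; split.
- by move=> f r bf /GH; apply: Huniq; exact: HL.
- move=> t f g bf bg; apply: Huniq (Hlin t _ _ (HL _ bf) (HL _ bg)).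
  apply: HL; have [B fB] := bf; have [C gC] := bg.
  exists (`|t| * B + C) => x; rewrite (le_trans (ler_normD _ _))// normrM.
  by rewrite lerD// ler_wpM2l.
- by move=> f bf f0; apply: Hpos (HL _ bf) f0.
Qed.

End positive_extension.

(** * From finitely additive contents to Borel measures *)

(** A monotone function has countably many discontinuities, and ]a, b[ is uncountable because its
    Lebesgue measure is positive. At a continuity point the one-sided limits agree, which makes the
    increment across t small. *)
Lemma nondecreasing_continuity_point (R : realType) (h : R -> R) (a b : R) :
  a < b -> {homo h : x y / x <= y} ->
  exists2 t, a < t < b &
    forall e, 0 < e -> exists2 s, 0 < s & h (t + s) - h (t - s) < e.
Proof.
move=> ab hmono.
have hI (i : interval R) : {in i &, {homo h : x y / x <= y}}.
  by move=> x y _ _; exact: hmono.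
have Dcount := @discontinuity_countable R a b h (hI _).
have [t [tab cont]] : exists t, (t \in `]a, b[) /\ ~ discontinuity h t.
  apply: contrapT => nex.
  have : countable `]a, b[%classic.
    apply: sub_countable Dcount; apply: subset_card_le => t tab; split => //.
    by apply: contrapT => nd; apply: nex; exists t.
  move=> /countable_lebesgue_measure0; rewrite lebesgue_measure_itv/= lte_fin ab.
  by move=> /eqP; rewrite -EFinB eqe subr_eq0 (gt_eqF ab).
have cvgl : cvg (h x @[x --> t^'-]).
  apply: nondecreasing_at_left_is_cvgr; apply: nearW => z; first exact: hI.
  by exists (h t) => _ [y + <-]; rewrite /= in_itv/= => /andP[_ yt]; exact/hmono/ltW.
have cvgr : cvg (h x @[x --> t^'+]).
  apply: nondecreasing_at_right_is_cvgr; apply: nearW => z; first exact: hI.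
  by exists (h t) => _ [y + <-]; rewrite /= in_itv/= => /andP[ty _]; exact/hmono/ltW.
have eqlr : lim (h x @[x --> t^'-]) = lim (h x @[x --> t^'+]).
  by apply/eqP; apply: contrapT => /negP neq; apply: cont.
exists t; first by move: tab; rewrite in_itv.
move=> e e0; set l := lim (h x @[x --> t^'+]) in eqlr.
have e20 : 0 < e / 2 by rewrite divr_gt0.
have [x1 x1t hx1] : exists2 x, x < t & l - e / 2 < h x.
  have : \forall x \near t^'-, l - e / 2 < h x.
    by apply: (cvgr_gt l); [rewrite -eqlr|rewrite gtrBl].
  move=> H; near (t^'-)%classic => x; exists x; near: x => //; exact: nbhs_left_lt.
have [x2 x2t hx2] : exists2 x, t < x & h x < l + e / 2.
  have : \forall x \near t^'+, h x < l + e / 2.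
    by apply: (cvgr_lt l); [exact: cvgr|rewrite ltrDl].
  move=> H; near (t^'+)%classic => x; exists x; near: x => //; exact: nbhs_right_gt.
exists (Num.min (t - x1) (x2 - t)); first by rewrite lt_min !subr_gt0 x1t.
set s := Num.min _ _.
have s1 : s <= t - x1 by rewrite ge_min lexx.
have s2 : s <= x2 - t by rewrite ge_min lexx orbT.
have h1 : h x1 <= h (t - s) by apply: hmono; lra.
have h2 : h (t + s) <= h x2 by apply: hmono; lra.
lra.
Unshelve. all: by end_near. Qed.

Section content.
Context {R : realType} {X : ptopologicalType}.
Variable m : set X -> R.
Hypothesis m_ge0 : forall A, 0 <= m A.
Hypothesis mU : forall A B, A `&` B = set0 -> m (A `|` B) = m A + m B.

Lemma content0 : m set0 = 0.
Proof.
have := mU (setI0 set0); rewrite setU0 => /eqP.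
by rewrite -subr_eq subrr => /eqP.
Qed.

Lemma content_le A B : A `<=` B -> m A <= m B.
Proof.
move=> AB; rewrite -(setDUK AB) mU ?lerDl//.
exact: setDIK.
Qed.

Lemma contentU A B : m (A `|` B) <= m A + m B.
Proof.
rewrite -(setDUK (@subsetUl _ A B)) mU ?lerD2l.
  by apply: content_le => x [[]].
exact: setDIK.
Qed.

Lemma content_bigcup (F : (set X)^nat) n :
  m (\bigcup_(i < n) F i) <= \sum_(i < n) m (F i).
Proof.
elim: n => [|n ih]; first by rewrite bigcup_mkord !big_ord0 content0.
rewrite bigcup_mkord !big_ord_recr /= -bigcup_mkord.
by rewrite (le_trans (contentU _ _))// lerD2r.
Qed.

(* The value +oo restricts mu_ext below to covers by open sets. *)
Definition open_content (A : set X) : \bar R :=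
  if `[< open A >] then (m A)%:E else +oo%E.

Local Notation borel := (g_sigma_algebraType (@open X)).
Definition outer_content : set borel -> \bar R := @mu_ext _ borel R open_content.
Local Notation mu := outer_content.

Lemma open_content0 : open_content set0 = 0%E.
Proof. by rewrite /open_content asboolT ?content0//; exact: open0. Qed.

Lemma open_content_ge0 A : (0 <= open_content A)%E.
Proof. by rewrite /open_content; case: ifP => // _; rewrite lee_fin. Qed.

Lemma open_contentE A : open A -> open_content A = (m A)%:E.
Proof. by move=> oA; rewrite /open_content asboolT. Qed.

HB.instance Definition _ := isOuterMeasure.Build R borel mu
  (@mu_ext0 _ borel _ _ open_content0 open_content_ge0)
  (@mu_ext_ge0 _ borel _ _ open_content_ge0) (@le_mu_ext _ borel _ open_content)
  (@mu_ext_sigma_subadditive _ borel _ _ open_content_ge0).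

Lemma outer_content_open (U : set X) : open U -> (mu U <= (m U)%:E)%E.
Proof.
move=> oU; apply: ereal_inf_lbound; exists (fun n => if n is 0%N then U else set0).
  split=> [[|n]|t Ut]; [exact: sub_sigma_algebra|exact: measurable0|by exists 0%N].
rewrite nneseries_recl//=; last by move=> n _; exact: open_content_ge0.
rewrite eseries0 ?adde0 ?open_contentE// => -[//|n] _ _.
exact: open_content0.
Qed.

(** A cover with a non-open member has total weight +oo, so only open covers count in the
    infimum. *)
Lemma outer_contentP (E : set X) (r : \bar R) :
  (forall B : (set X)^nat, (forall i, open (B i)) -> E `<=` \bigcup_i B i ->
    (r <= \sum_(i <oo) (m (B i))%:E)%E) -> (r <= mu E)%E.
Proof.
move=> Hr; apply: le_ereal_inf_tmp => _ [B [mB EB] <-].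
have [oB|] := pselect (forall i, open (B i)).
  rewrite (eq_eseriesr (g := fun i => (m (B i))%:E)); first exact: Hr.
  by move=> i _; rewrite open_contentE.
move=> /existsNP[i nB]; rewrite (@eseries_pinfty _ _ _ i) ?leey//.
  by move=> n _; rewrite gt_eqF// (lt_le_trans _ (open_content_ge0 _)).
by rewrite /open_content asboolF.
Qed.

(* The outer measure splits along the level t because the two open sets g > t
   and g < t are disjoint and the shell around t between them is negligible. *)
Lemma caratheodory_level (g : X -> R) t : continuous g ->
  (forall e, 0 < e -> exists2 s, 0 < s & m [set x | t - s < g x < t + s] < e) ->
  @caratheodory_measurable R borel mu [set x | t < g x].
Proof.
move=> gcont thin; apply: (@le_caratheodory_measurable R borel mu) => E.
apply: outer_contentP => B oB EB; apply/lee_addgt0Pr => e e0.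
have [s s0 ms] := thin e e0.
have gopen A : open A -> open (g @^-1` A) by move/continuousP: gcont; apply.
have oG : open [set x | t < g x].
  exact: (gopen _ (@open_gt _ t)).
have oL : open [set x | g x < t].
  exact: (gopen _ (@open_lt _ t)).
have oS : open [set x | t - s < g x < t + s].
  have -> : [set x | t - s < g x < t + s] =
      [set x | t - s < g x] `&` [set x | g x < t + s].
    by apply/seteqP; split=> x /= => [/andP[]|[-> ->]].
  apply: openI.
    exact: (gopen _ (@open_gt _ (t - s))).
  exact: (gopen _ (@open_lt _ (t + s))).
have H1 : (mu (E `&` [set x | (t < g x)%R]) <=
    \sum_(i <oo) (m (B i `&` [set x | (t < g x)%R]))%:E)%E.
  apply: le_trans (le_outer_measure mu _ (\bigcup_i (B i `&` [set x | t < g x])) _) _.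
    by move=> x [/EB[i _ Bx] gx]; exists i.
  apply: le_trans (outer_measure_sigma_subadditive mu _) _.
  apply: lee_nneseries => [i _ _|i _]; first exact: outer_measure_ge0.
  exact/outer_content_open/openI.
(* Where g <= t, either g < t, or g = t and the point lies in the shell, whose content is below
   e. *)
have H2 : (mu (E `&` ~` [set x | (t < g x)%R]) <=
    e%:E + \sum_(i <oo) (m (B i `&` [set x | (g x < t)%R]))%:E)%E.
  pose C := \bigcup_i (B i `&` [set x | g x < t]).
  apply: le_trans (le_outer_measure mu _ ([set x | t - s < g x < t + s] `|` C) _) _.
    move=> x [/EB[i _ Bx] /negP]; rewrite -leNgt => gx.
    have [gt|gt] := ltP (g x) t; first by right; exists i.
    by left; rewrite /=; apply/andP; split; lra.
  apply: le_trans (outer_measureU2 mu _ _) _; apply: leeD.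
    by apply: le_trans (outer_content_open oS) _; rewrite lee_fin ltW.
  apply: le_trans (outer_measure_sigma_subadditive mu _) _.
  apply: lee_nneseries => [i _ _|i _]; first exact: outer_measure_ge0.
  exact/outer_content_open/openI.
apply: le_trans (leeD H1 H2) _.
rewrite addeCA addeC leeD2r// -nneseriesD//; try by move=> i _ _; rewrite lee_fin.
apply: lee_nneseries => i _; first by rewrite adde_ge0// lee_fin.
rewrite -EFinD lee_fin -mU.
  by apply: content_le => x [[]|[]].
by apply/seteqP; split => x //= -[[_ tg] [_ gt]]; move: (lt_trans tg gt); rewrite ltxx.
Qed.

(** The shell and {g <= t - s} are disjoint subsets of {g <= t + s}, so the content of the shell is
    at most an increment of t |-> m {g <= t}, which is small at a continuity point. *)
Lemma exists_thin_level (g : X -> R) (a b : R) : a < b ->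
  exists2 t, a < t < b &
    forall e, 0 < e -> exists2 s, 0 < s & m [set x | t - s < g x < t + s] < e.
Proof.
move=> ab; pose h t := m [set x | g x <= t].
have hmono : {homo h : s t / s <= t}.
  by move=> s t st; apply: content_le => x /= /le_trans; apply.
have [t tab thin] := nondecreasing_continuity_point ab hmono.
exists t => // e /thin[s s0 hs]; exists s => //.
apply: le_lt_trans hs; rewrite lerBrDl -mU.
  apply: content_le => x /= [|/andP[_ /ltW//]].
  by move=> /le_trans; apply; lra.
by apply/seteqP; split => x //= -[xs /andP[+ _]]; rewrite ltNge xs.
Qed.

(** The set is the union of the superlevel sets of g at thin levels t_n in ]0, 1/(n+1)[. *)
Lemma caratheodory_cozero (g : X -> R) : continuous g ->
  @caratheodory_measurable R borel mu [set x | 0 < g x].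
Proof.
move=> gcont.
have /choice[t tP] (n : nat) : exists t, 0 < t < n.+1%:R^-1 /\
    forall e, 0 < e -> exists2 s, 0 < s & m [set x | t - s < g x < t + s] < e.
  have [|t t0 tP] := @exists_thin_level g 0 n.+1%:R^-1; first by rewrite invr_gt0.
  by exists t.
have -> : [set x | 0 < g x] = \bigcup_n [set x | t n < g x].
  apply/seteqP; split=> x /= => [gx|[n _ /=]]; last first.
    by apply: lt_trans; have [/andP[]] := tP n.
  have [n] := ltr_add_invr gx; rewrite add0r => ngx; exists n => //=.
  by apply: lt_trans ngx; have [/andP[]] := tP n.
apply: caratheodory_measurable_bigcup => n; apply: caratheodory_level => //.
by have [] := tP n.
Qed.

Hypothesis X_compact : compact [set: X].
Hypothesis X_cozero : forall U : set X, open U ->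
  exists2 g : X -> R, continuous g & U = [set x | 0 < g x].

Lemma outer_contentT : mu setT = (m setT)%:E.
Proof.
apply/eqP; rewrite eq_le outer_content_open/=; last exact: openT.
apply: outer_contentP => B oB cB.
have [D _ DX] : finite_subset_cover [set: nat] B [set: X].
  by move: X_compact; rewrite compact_cover; apply.
pose n := (\max_(i <- enum_fset D) i).+1.
have sub : [set: X] `<=` \bigcup_(i < n) B i.
  move=> x /DX[i /= iD Bx]; exists i => //=.
  by rewrite /n ltnS; apply: leq_bigmax_seq.
apply: le_trans (nneseries_lim_ge n _); last by move=> *; rewrite lee_fin.
rewrite big_mkord sumEFin lee_fin.
exact: le_trans (content_le sub) (content_bigcup _ _).
Qed.

Lemma borel_caratheodory :
  (measurable : set (set borel)) `<=` @caratheodory_measurable R borel mu.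
Proof.
apply: smallest_sub.
  split; [exact: caratheodory_measurable_set0| |exact: caratheodory_measurable_bigcup].
  by move=> A mA; rewrite setTD; exact: caratheodory_measurable_setC.
by move=> U /X_cozero[g gcont ->]; exact: caratheodory_cozero.
Qed.

Lemma borel_content_sigma_additive : semi_sigma_additive (mu : set borel -> \bar R).
Proof.
move=> F mF tF mUF; apply: (@caratheodory_measure_sigma_additive _ _ mu) => //.
- by move=> i; exact: borel_caratheodory.
- exact: borel_caratheodory.
Qed.

Lemma borel_measure_of_content :
  exists nu : {finite_measure set borel -> \bar R},
    nu setT = (m setT)%:E /\ forall U, open U -> (nu U <= (m U)%:E)%E.
Proof.
pose M := isMeasure.Build _ borel R mu (outer_measure0 mu) (outer_measure_ge0 mu)
  borel_content_sigma_additive.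
pose nu : {measure set borel -> \bar R} := HB.pack (mu : set borel -> \bar R) M.
have nufin : fin_num_fun nu.
  move=> A mA; rewrite ge0_fin_numE ?outer_measure_ge0//.
  apply: le_lt_trans (ltry (m setT)); rewrite -outer_contentT.
  exact: (le_outer_measure mu).
pose N := Measure_isFinite.Build _ borel R nu nufin.
pose nu' : {finite_measure set borel -> \bar R} :=
  HB.pack (mu : set borel -> \bar R) M N.
exists nu'; split; [exact: outer_contentT|exact: outer_content_open].
Qed.

End content.

(** The sum is the ceiling of z. The estimate serves to compare a function with the step function
    built from its superlevel sets. *)
Lemma count_below (R : realType) (N : nat) (z : R) : 0 <= z <= N%:R ->
  z <= \sum_(i < N) (i%:R < z)%R%:R <= z + 1.
Proof.
move=> /andP[z0 zN].
have le_count (n : nat) : \sum_(i < n) (i%:R < z)%R%:R <= n%:R :> R.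
  have -> : n%:R = \sum_(i < n) 1 :> R by rewrite sumr_const card_ord.
  by apply: ler_sum => i _; case: (_ < _).
apply/andP; split; last first.
  elim: N {zN} => [|n ih]; first by rewrite big_ord0 addr_ge0.
  rewrite big_ord_recr /=; have [nz|nz] := ltP n%:R z; last by rewrite addr0.
  by rewrite lerD// (le_trans (le_count n))// ltW.
elim: N zN => [|n ih] zN; first by rewrite big_ord0.
rewrite big_ord_recr /=; have [nz|nz] := ltP n%:R z; last by rewrite addr0 ih.
rewrite (eq_bigr (fun=> 1)); last first.
  by move=> i _; rewrite (lt_trans _ nz)// ltr_nat.
by rewrite sumr_const card_ord -mulrSr.
Qed.

Section bounded_functions.
Context {R : realType} {X : Type}.
Implicit Types (f g : X -> R) (t : R).

Lemma real_bounded_cst t : real_bounded (fun _ : X => t).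
Proof. by exists `|t|. Qed.

Lemma real_bounded_lin t f g : real_bounded f -> real_bounded g ->
  real_bounded (fun x => t * f x + g x).
Proof.
move=> [B fB] [C gC]; exists (`|t| * B + C) => x.
by rewrite (le_trans (ler_normD _ _))// normrM lerD// ler_wpM2l.
Qed.

Lemma real_bounded_indic (A : set X) : real_bounded (\1_A : X -> R).
Proof.
exists 1 => x; rewrite indicE ger0_norm//.
by case: (_ \in _).
Qed.

(** [P] is a domain on which [L] is linear: bounded measurable functions for the integral, all
    bounded functions for an extended functional. *)
Lemma linear_functional_sum (P : (X -> R) -> Prop) (L : (X -> R) -> R) :
  P (fun=> 0) ->
  (forall t f g, P f -> P g -> P (fun x => t * f x + g x)) ->
  (forall t f g, P f -> P g -> L (fun x => t * f x + g x) = t * L f + L g) ->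
  forall n (a : 'I_n -> R) (f : 'I_n -> X -> R), (forall i, P (f i)) ->
  P (fun x => \sum_(i < n) a i * f i x) /\
  L (fun x => \sum_(i < n) a i * f i x) = \sum_(i < n) a i * L (f i).
Proof.
move=> P0 Plin Llin; have L0 : L (fun=> 0) = 0.
  transitivity (L (fun=> -1 * 0 + 0)).
    by congr L; apply/funext => x; rewrite mulr0 addr0.
  by rewrite Llin// mulN1r addNr.
elim=> [|n ih] a f Pf.
  have -> : (fun x => \sum_(i < 0) a i * f i x) = (fun=> 0).
    by apply/funext => x; rewrite big_ord0.
  by rewrite big_ord0.
have -> : (fun x => \sum_(i < n.+1) a i * f i x) = (fun x => a ord0 * f ord0 x +
    \sum_(i < n) a (lift ord0 i) * f (lift ord0 i) x).
  by apply/funext => x; rewrite big_ord_recl.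
have [Psum Lsum] := ih (fun i => a (lift ord0 i)) (fun i => f (lift ord0 i))
  (fun i => Pf _).
by split; [exact: Plin|rewrite Llin// Lsum big_ord_recl].
Qed.

End bounded_functions.

Section continuous_integral.
Context {R : realType} {X : ptopologicalType}.
Local Notation borel := (g_sigma_algebraType (@open X)).
Implicit Types f g : X -> R.

Lemma continuous_borel_measurable f : continuous f ->
  measurable_fun [set: borel] (f : borel -> R).
Proof.
move=> fcont; apply: (measurability _ (measurable_realfun.RGenOInfty.measurableE R)).
move=> _ [_ [a ->] <-]; rewrite setTI; apply: sub_sigma_algebra.
by move/continuousP: fcont; apply; exact: interval_open.
Qed.

Variable mu : {finite_measure set borel -> \bar R}.

Lemma bounded_integrable f : measurable_fun [set: borel] (f : borel -> R) ->
  real_bounded f -> mu.-integrable [set: borel] (EFin \o f).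
Proof.
move=> mf [M fM]; apply: measurable_bounded_integrable => //.
  by rewrite ltey_eq fin_num_measure.
exists M; split; first exact: num_real.
by move=> N MN x _; rewrite /= (le_trans (fM x))// ltW.
Qed.

Lemma continuous_integrable f : continuous f -> real_bounded f ->
  mu.-integrable [set: borel] (EFin \o f).
Proof. by move=> /continuous_borel_measurable; exact: bounded_integrable. Qed.

Lemma le_Rintegral (f g : borel -> R) : mu.-integrable [set: borel] (EFin \o f) ->
  mu.-integrable [set: borel] (EFin \o g) -> (forall x, f x <= g x) ->
  \int[mu]_x f x <= \int[mu]_x g x.
Proof.
move=> fi gi fg; rewrite -subr_ge0 -RintegralB//.
by apply: Rintegral_ge0 => x _; rewrite subr_ge0.
Qed.

Lemma Rintegral_lin t (f g : X -> R) :
  measurable_fun [set: borel] (f : borel -> R) -> real_bounded f ->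
  measurable_fun [set: borel] (g : borel -> R) -> real_bounded g ->
  \int[mu]_x (t * f x + g x) = t * \int[mu]_x f x + \int[mu]_x g x.
Proof.
move=> mf bf mg bg; have int_f := bounded_integrable mf bf.
rewrite RintegralD ?RintegralZl//; last exact: bounded_integrable.
have := integrableZl measurableT t int_f.
by congr integrable; apply/funext => x; rewrite /= EFinM.
Qed.

End continuous_integral.

(** * Riesz representation of positive functionals on a compact space *)

Section representation.
Context {R : realType} {X : ptopologicalType}.
Local Notation borel := (g_sigma_algebraType (@open X)).
Hypothesis X_compact : compact [set: X].
Hypothesis X_cozero : forall U : set X, open U ->
  exists2 g : X -> R, continuous g & U = [set x | 0 < g x].
Variable L : (X -> R) -> R.
Hypothesis L_linear : forall t f g, real_bounded f -> real_bounded g ->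
  L (fun x => t * f x + g x) = t * L f + L g.
Hypothesis L_ge0 : forall f, real_bounded f -> (forall x, 0 <= f x) -> 0 <= L f.

Let le_L (f g : X -> R) : real_bounded f -> real_bounded g ->
  (forall x, f x <= g x) -> L f <= L g.
Proof.
move=> bf bg fg; rewrite -subr_ge0.
have := L_linear (-1) bf bg; rewrite mulN1r addrC => <-.
by apply: L_ge0; [exact: real_bounded_lin|move=> x; rewrite mulN1r addrC subr_ge0].
Qed.

Let m (A : set X) : R := L (\1_A).

Let m_ge0 A : 0 <= m A.
Proof. by apply: L_ge0 => [|x]; [exact: real_bounded_indic|rewrite indicE]. Qed.

Let mU A B : A `&` B = set0 -> m (A `|` B) = m A + m B.
Proof.
move=> AB; rewrite -[m A]mul1r -L_linear; try exact: real_bounded_indic.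
congr L; apply/funext => x.
rewrite mul1r !indicE in_setU; have [xA|xA] := boolP (x \in A) => /=; last first.
  by rewrite add0r.
suff /negbTE-> : x \notin B by rewrite addr0.
apply/negP => xB; have : (A `&` B) x by split; exact: set_mem.
by rewrite AB.
Qed.

Lemma positive_functional_measure :
  exists mu : {finite_measure set borel -> \bar R},
    forall f : X -> R, continuous f -> real_bounded f -> \int[mu]_x f x = L f.
Proof.
have [mu [muT muU]] := borel_measure_of_content m_ge0 mU X_compact X_cozero.
exists mu.
have L_cst t : L (fun=> t) = t * L (fun=> 1).
  rewrite -[RHS]addr0 -[X in _ = _ + X](_ : L (fun=> 0) = 0).
    rewrite -L_linear; try exact: real_bounded_cst.
    by congr L; apply/funext => x; rewrite mulr1 addr0.
  transitivity (L (fun=> -1 * 0 + 0)).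
    by congr L; apply/funext => x; rewrite mulr0 addr0.
  by rewrite L_linear ?mulN1r ?addNr//; exact: real_bounded_cst.
(* Constants are integrated exactly because the total mass of [mu] is the content of the whole
   space, that is, L(1). *)
have int_cst (t : R) : \int[mu]_x t = L (fun=> t).
  rewrite Rintegral_cst// L_cst [X in fine X]muT /= /m; congr (_ * L _).
  by apply/funext => x; rewrite indicT.
have upper (f : X -> R) : continuous f -> (forall x, 0 <= f x <= 1) ->
    \int[mu]_x f x <= L f.
  move=> fcont f01.
  have bf : real_bounded f.
    by exists 1 => x; have /andP[f0 f1] := f01 x; rewrite ger0_norm.
  have int_f := continuous_integrable mu fcont bf.
  suff H n : \int[mu]_x f x <= L f + n.+1%:R^-1 * L (fun=> 1).
    apply/ler_addgt0Pr => e e0.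
    have L1 : 0 <= L (fun=> 1) by apply: L_ge0 => //; exact: real_bounded_cst.
    have [n] := @ltr_add_invr R 0 (e / (L (fun=> 1) + 1))
      (divr_gt0 e0 (ltr_wpDl L1 ltr01)).
    rewrite add0r ltr_pdivlMr ?ltr_wpDl// => ne.
    apply: le_trans (H n) _; rewrite lerD2l (le_trans _ (ltW ne))//.
    by rewrite ler_wpM2l// lerDl.
  (* The step function s = (1/N) sum_(i < N) 1_(f > i/N), with N = n + 1, satisfies
     f <= s <= f + 1/N, and mu is at most m on the open superlevel sets. *)
  pose U (i : 'I_n.+1) := [set x | i%:R / n.+1%:R < f x].
  have oU i : open (U i).
    by move/continuousP: fcont => /(_ _ (@open_gt _ (i%:R / n.+1%:R))).
  have mUi i : measurable (U i : set borel) by exact: sub_sigma_algebra.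
  pose s x : R := \sum_(i < n.+1) n.+1%:R^-1 * \1_(U i) x.
  have fs x : f x <= s x <= f x + n.+1%:R^-1.
    have n0 : 0 < n.+1%:R :> R by [].
    have /andP[f0 f1] := f01 x.
    have := @count_below R n.+1 (n.+1%:R * f x).
    rewrite mulr_ge0//= ler_piMr// => /(_ isT).
    have -> : \sum_(i < n.+1) (i%:R < n.+1%:R * f x)%R%:R = n.+1%:R * s x.
      rewrite /s mulr_sumr; apply: eq_bigr => i _.
      rewrite mulrA divff ?gt_eqF// mul1r indicE; congr (nat_of_bool _)%:R.
      rewrite mulrC -ltr_pdivrMr//.
      by apply/idP/idP => [H|/set_mem//]; apply: mem_set.
    rewrite ler_pM2l// => /andP[-> H]; rewrite -(ler_pM2l n0) mulrDr.
    by rewrite divff ?gt_eqF.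
  pose P g := measurable_fun [set: borel] (g : borel -> R) /\ real_bounded g.
  have Plin t g h : P g -> P h -> P (fun x => t * g x + h x).
    move=> [mg bg] [mh bh]; split; last exact: real_bounded_lin.
    apply: measurable_realfun.measurable_funD => //.
    by apply: measurable_realfun.measurable_funM => //; exact: measurable_cst.
  have P0 : P (fun=> 0) by split; [exact: measurable_cst|exact: real_bounded_cst].
  have PU i : P (\1_(U i)).
    by split; [exact: measurable_realfun.measurable_indic|exact: real_bounded_indic].
  have [[ms bs] int_s] := linear_functional_sum P0 Plin
    (fun t g h Pg Ph => Rintegral_lin mu t Pg.1 Pg.2 Ph.1 Ph.2)
    (fun=> n.+1%:R^-1) PU.
  have [_ Ls] := linear_functional_sum (real_bounded_cst 0)
    (@real_bounded_lin R X) L_linear (fun=> n.+1%:R^-1) (fun i => (PU i).2).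
  (* The integral of s is the average of the mu(U i) and L(s) is that of the m(U i); the sets U i
     are open. *)
  have int_s_le : \int[mu]_x s x <= L s.
    rewrite [leLHS]int_s [leRHS]Ls; apply: ler_sum => i _.
    rewrite ler_wpM2l// /Rintegral integral_indic// setIT.
    rewrite -lee_fin fineK ?fin_num_measure//.
    exact: muU.
  apply: le_trans (le_Rintegral int_f (bounded_integrable mu ms bs) _) _.
    by move=> x; have /andP[] := fs x.
  apply: le_trans int_s_le _; rewrite addrC -L_linear//; last exact: real_bounded_cst.
  apply: le_L => //; first exact/real_bounded_lin/bf/real_bounded_cst.
  by move=> x; have /andP[_] := fs x; rewrite mulr1 addrC.
have lin_int t s (f : X -> R) : continuous f -> real_bounded f ->
    \int[mu]_x (t * f x + s) = t * \int[mu]_x f x + L (fun=> s).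
  move=> fcont bf; rewrite Rintegral_lin ?int_cst//.
  - exact: continuous_borel_measurable.
  - exact: real_bounded_cst.
have cont_lin t s (f : X -> R) : continuous f -> continuous (fun x => t * f x + s).
  move=> fcont x; apply: cvgD; last exact: cvg_cst.
  by apply: cvgM; [exact: cvg_cst|exact: fcont].
have exact01 (f : X -> R) : continuous f -> (forall x, 0 <= f x <= 1) ->
    \int[mu]_x f x = L f.
  move=> fcont f01; apply/eqP; rewrite eq_le upper//=.
  have bf : real_bounded f.
    by exists 1 => x; have /andP[f0 f1] := f01 x; rewrite ger0_norm.
  (* The upper bound for 1 - f is the lower bound for f, since constants are integrated exactly. *)
  have := upper (fun x => -1 * f x + 1).
  rewrite lin_int// L_linear//; last exact: real_bounded_cst.
  rewrite lerD2r !mulN1r lerN2; apply.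
    exact: cont_lin.
  by move=> x; have /andP[f0 f1] := f01 x; apply/andP; split; lra.
move=> f fcont [B fB].
have B0 : 0 <= B by apply: le_trans (fB point); exact: normr_ge0.
(* The affine change C f + 1/2 has values in [0, 1]; B + 1 in place of B keeps the divisor
   nonzero. *)
pose C := (2 * (B + 1))^-1.
have C0 : 0 < C by rewrite invr_gt0; lra.
have bf : real_bounded f by exists B.
have := exact01 (fun x => C * f x + 2^-1).
rewrite lin_int// L_linear//; last exact: real_bounded_cst.
move=> H; apply: (mulfI (lt0r_neq0 C0)); apply: (addIr (L (fun=> 2^-1))); apply: H.
  exact: cont_lin.
move=> x; have := fB x; rewrite ler_norml => /andP[fl fu].
have CB : C * B <= 2^-1.
  by rewrite /C mulrC ler_pdivrMr; lra.
have h1 : C * f x <= C * B by rewrite ler_wpM2l// ltW.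
have h2 : - (C * B) <= C * f x by rewrite -mulrN ler_wpM2l// ltW.
by apply/andP; split; lra.
Qed.

End representation.

(** * Topology of the torus *)

Section torus_topology.
Context {R : realType} {k : nat}.
Implicit Types z y : torus R k.

Lemma gt0_complexE (e : R[i]) : 0 < e -> e = (complex.Re e)%:C /\ 0 < complex.Re e.
Proof.
move=> e0; rewrite RRe_real ?gtr0_real//; split=> //.
by rewrite -ltcR RRe_real// gtr0_real.
Qed.

Lemma normc_ge_Im (c : R[i]) : `|complex.Im c|%:C <= `|c|.
Proof.
case: c => a b.
by rewrite normc_def lecR /= -sqrtr_sqr ler_wsqrtr// lerDr sqr_ge0.
Qed.

Lemma normc_le (a b : R) : `|a +i* b| <= (`|a| + `|b|)%:C.
Proof.
rewrite [a +i* b]complexE (le_trans (ler_normD _ _))//= rmorphD /= normrM.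
by rewrite !normc_def /= !expr0n expr1n add0r sqrtr1 mul1r !addr0 !sqrtr_sqr.
Qed.

(** Balls of [R[i]^o] have radii in [R[i]]; a positive radius is real, so neighbourhoods can be
    described coordinatewise with radii in [R]. *)
Lemma nbhs_torusP z (A : set (torus R k)) :
  nbhs z A <-> exists2 e : R, 0 < e &
    forall y, (forall j, `|coordinate z j - coordinate y j| < e%:C) -> A y.
Proof.
split.
  move=> [_ [/= [C oC <-] /= Cz]] CA.
  have : nbhs (\val z : 'rV[R[i]^o]_k) C by exact: open_nbhs_nbhs.
  move=> /nbhs_ballP[e /= e0 eC].
  have [eE e0'] := gt0_complexE e0.
  exists (complex.Re e) => // y yz; apply: CA; apply: eC; split => // i j.
  by rewrite ord1 /ball /= eE; exact: yz.
move=> [e e0 eA].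
have ec0 : 0 < e%:C by rewrite ltcR.
exists (\val @^-1` ((ball (\val z : 'rV[R[i]^o]_k) e%:C)^°)); split => //=.
- by exists ((ball (\val z : 'rV[R[i]^o]_k) e%:C)^°) => //; exact: open_interior.
- rewrite /interior/=; exact: nbhsx_ballx.
- move=> y /interior_subset [_ yz]; apply: eA => j.
  by have := yz 0 j; rewrite /ball /=.
Qed.

Lemma continuous_torus (f : torus R k -> R) :
  (forall z e, 0 < e -> exists2 d, 0 < d &
    forall y, (forall j, `|coordinate z j - coordinate y j| < d%:C) ->
      `|f z - f y| < e) -> continuous f.
Proof.
move=> H z A /nbhs_ballP[e /= e0 eA].
have [d d0 Hd] := H z e e0.
by apply/nbhs_torusP; exists d => // y zy; apply: eA; exact: Hd.
Qed.

Lemma continuous_Re_coordinate j :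
  continuous (fun z => complex.Re (coordinate z j) : R).
Proof.
apply: continuous_torus => z e e0; exists e => // y /(_ j) zy.
by rewrite -raddfB -ltcR (le_lt_trans (normc_ge_Re _)).
Qed.

Lemma continuous_Im_coordinate j :
  continuous (fun z => complex.Im (coordinate z j) : R).
Proof.
apply: continuous_torus => z e e0; exists e => // y /(_ j) zy.
rewrite -ltcR; apply: le_lt_trans zy.
have := normc_ge_Im (coordinate z j - coordinate y j).
by case: (coordinate z j) (coordinate y j) => ? ? [].
Qed.

Lemma torus_cozero (k_gt0 : (0 < k)%N) (U : set (torus R k)) : open U ->
  exists2 g : torus R k -> R, continuous g & U = [set x | 0 < g x].
Proof.
move=> oU.
(* g z is the truncated distance from z to the complement of U. *)
pose S z := [set r : R | 0 <= r <= 1 /\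
  forall y, (forall j, `|coordinate z j - coordinate y j| < r%:C) -> U y].
(* For r = 0 no y qualifies: k > 0 provides a coordinate, at which a norm would be negative. *)
have S0 z : S z 0.
  split; first by rewrite lexx ler01.
  by move=> y /(_ (Ordinal k_gt0)) /(le_lt_trans (normr_ge0 _)); rewrite ltcR ltxx.
have ubS z : ubound (S z) 1 by move=> r [/andP[]].
have supS z : has_sup (S z) by split; [exists 0|exists 1].
have g0 z : 0 <= sup (S z) by apply: sup_upper_bound.
exists (fun z => sup (S z)).
  apply: continuous_torus => z e e0; exists (e / 2); first by rewrite divr_gt0.
  (* If the ball of radius r at x lies in U, so does the ball of radius r - e/2 at y. *)
  have lip x y : (forall j, `|coordinate x j - coordinate y j| < (e / 2)%:C) ->
      sup (S x) <= sup (S y) + e / 2.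
    move=> xy; apply: ge_sup => [|r [/andP[r0 r1] Sr]]; first by exists 0.
    have [re|re] := leP r (e / 2); first by rewrite (le_trans re)// lerDr.
    rewrite -lerBlDr; apply: sup_upper_bound => //; split.
      by apply/andP; split; lra.
    move=> w yw; apply: Sr => j.
    rewrite -(subrKA (coordinate y j)) (le_lt_trans (ler_normD _ _))//.
    by rewrite -[r](subrK (e / 2)) addrC rmorphD /= ltrD.
  move=> y zy; rewrite (@le_lt_trans _ _ (e / 2))//; last by lra.
  rewrite ler_distl; apply/andP; split.
    by rewrite lerBlDr lip// => j; rewrite distrC.
  exact: lip.
apply/seteqP; split => z /=.
  move=> Uz; have /nbhs_torusP[e e0 eU] : nbhs z U by exact: open_nbhs_nbhs.
  apply: (@lt_le_trans _ _ (Num.min e 1)); first by rewrite lt_min e0 ltr01.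
  apply: sup_upper_bound => //; split.
    by rewrite le_min ge_min lexx ler01 (ltW e0) orbT.
  move=> y zy; apply: eU => j; apply: lt_le_trans (zy j) _.
  by rewrite lecR ge_min lexx.
move=> /(sup_gt (ex_intro _ 0 (S0 z)))[r [_ Sr] r0]; apply: Sr => j.
by rewrite subrr normr0 ltcR.
Qed.

(** The circle is a continuous image of the real curve a^2 + b^2 = 1, which is closed in a product
    of two segments. *)
Lemma circle_compact : compact [set c : R[i]^o | `|c| = 1].
Proof.
pose K := [set p : R * R | p.1 ^+ 2 + p.2 ^+ 2 = 1].
pose f (p : R * R) : R[i]^o := p.1 +i* p.2.
have -> : [set c : R[i]^o | `|c| = 1] = f @` K.
  apply/seteqP; split => [[a b] /= ab1|_ [[a b] /= ab1 <-]].
    exists (a, b) => //; apply: complexI.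
    transitivity (`|a +i* b| ^+ 2); last by rewrite ab1 expr1n.
    by rewrite -add_Re2_Im2.
  by rewrite normc_def /= ab1 sqrtr1.
apply: continuous_compact.
  apply: continuous_subspaceT => -[a b] A /nbhs_ballP[e /gt0_complexE[eE e0] eA].
  have e20 : 0 < complex.Re e / 2 by rewrite divr_gt0.
  exists (ball a (complex.Re e / 2), ball b (complex.Re e / 2)) => /=.
    by split; exact: nbhsx_ballx.
  move=> [c d] [/= ac bd]; apply: eA; rewrite /ball /= eE.
  apply: le_lt_trans (normc_le (a - c) (b - d)) _.
  by rewrite ltcR [ltRHS]splitr ltrD.
have KI : K `<=` `[-1, 1]%classic `*` `[-1, 1]%classic.
  move=> [a b] /= ab1; split; rewrite /= in_itv/= -ler_norml -(expr_le1 (n := 2))//;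
  by rewrite real_normK ?num_real// -ab1 ?lerDl ?lerDr ?sqr_ge0.
apply: (subclosed_compact _ _ KI); last first.
  by apply: compact_setX; exact: segment_compact.
have -> : K = (fun p : R * R => p.1 ^+ 2 + p.2 ^+ 2) @^-1` [set 1] by [].
apply: closed_comp; last exact: closed_eq.
by move=> p _; apply: cvgD; apply: cvgM; (exact: cvg_fst || exact: cvg_snd).
Qed.

(** A product of circles is compact in C^k. A filter on the subspace type is pushed forward there,
    and the cluster point found there is pulled back. *)
Lemma torus_compact : compact [set: torus R k].
Proof.
have cT : compact (torus_set R k).
  exact: (rV_compact (fun _ : 'I_k => circle_compact)).
move=> F FF _.
pose G : set_system 'rV[R[i]^o]_k := (fun z : torus R k => \val z) @ F.
have GF : ProperFilter G by exact: fmap_proper_filter.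
have [p [pT clp]] : torus_set R k `&` cluster G !=set0.
  apply: cT; rewrite /G /= /fmap /=.
  apply: filterS filterT => z _ /=; exact/set_mem/valP.
exists (exist _ p (mem_set pT)); split => // A B FA [_ [[C oC <-] /= Cp] CB].
have GA : G ((fun z : torus R k => \val z) @` A).
  by apply: (@filterS _ F _ A) => // z Az; exists z.
have [_ [[z Az <-] Cz]] := clp _ _ GA (open_nbhs_nbhs (conj oC Cp)).
by exists z; split => //; exact: CB.
Qed.

Definition complex_continuous (f : torus R k -> R[i]) :=
  continuous (fun z => complex.Re (f z) : R) /\
  continuous (fun z => complex.Im (f z) : R).

Lemma complex_continuousM f g : complex_continuous f -> complex_continuous g ->
  complex_continuous (fun z => f z * g z).
Proof.
move=> [fr fi] [gr gi]; split.
  have -> : (fun z => complex.Re (f z * g z)) =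
    (fun z => complex.Re (f z) * complex.Re (g z) -
              complex.Im (f z) * complex.Im (g z)).
    by apply/funext => z; case: (f z) (g z) => ? ? [].
  by move=> z; exact: (cvgB (cvgM (fr z) (gr z)) (cvgM (fi z) (gi z))).
have -> : (fun z => complex.Im (f z * g z)) =
  (fun z => complex.Re (f z) * complex.Im (g z) +
            complex.Im (f z) * complex.Re (g z)).
  by apply/funext => z; case: (f z) (g z) => ? ? [].
by move=> z; exact: (cvgD (cvgM (fr z) (gi z)) (cvgM (fi z) (gr z))).
Qed.

Lemma complex_continuous_conj f : complex_continuous f ->
  complex_continuous (fun z => (f z)^*%C).
Proof.
move=> [fr fi]; split.
  have -> : (fun z => complex.Re (f z)^*%C) = (fun z => complex.Re (f z)).
    by apply/funext => z; case: (f z).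
  exact: fr.
have -> : (fun z => complex.Im (f z)^*%C) = (fun z => - complex.Im (f z)).
  by apply/funext => z; case: (f z).
by move=> z; exact: (cvgN (fi z)).
Qed.

Lemma complex_continuous1 : complex_continuous (fun=> 1).
Proof. by split; exact: cst_continuous. Qed.

Lemma complex_continuousX f n : complex_continuous f ->
  complex_continuous (fun z => f z ^+ n).
Proof.
move=> fc; elim: n => [|n ih]; first exact: complex_continuous1.
have -> : (fun z => f z ^+ n.+1) = (fun z => f z * f z ^+ n).
  by apply/funext => z; rewrite exprS.
exact: complex_continuousM.
Qed.

Lemma norm_coordinate z j : `|coordinate z j| = 1.
Proof. by have := set_mem (valP z); exact. Qed.

Lemma unit_norm_inv (c : R[i]) : `|c| = 1 -> c^-1 = c^*%C.
Proof. by move=> c1; rewrite invc_norm c1 expr1n invr1 mul1r. Qed.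

Lemma norm_exprz (c : R[i]) (n : int) : `|c| = 1 -> `|c ^ n| = 1.
Proof.
move=> c1; case: n => n; first by rewrite -exprnP normrX c1 expr1n.
by rewrite NegzE -exprnN normfV normrX c1 expr1n invr1.
Qed.

Lemma norm_monomial al z : `|monomial al z| = 1.
Proof.
rewrite /monomial normr_prod big1// => j _.
exact/norm_exprz/norm_coordinate.
Qed.

Lemma complex_continuous_monomial al : complex_continuous (monomial al).
Proof.
have cj j : complex_continuous (fun z => coordinate z j).
  by split; [exact: continuous_Re_coordinate|exact: continuous_Im_coordinate].
have cjz j (n : int) : complex_continuous (fun z => coordinate z j ^ n).
  case: n => n; first exact: complex_continuousX.
  have -> : (fun z => coordinate z j ^ Negz n) =
      (fun z => (coordinate z j ^+ n.+1)^*%C).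
    apply/funext => z; rewrite NegzE -exprnN unit_norm_inv//.
    by rewrite normrX norm_coordinate expr1n.
  exact/complex_continuous_conj/complex_continuousX.
rewrite /monomial; elim: (index_enum _) => [|j s ih].
  have -> : (fun z : torus R k => \prod_(j <- [::]) coordinate z j ^ al 0 j) = fun=> 1.
    by apply/funext => z; rewrite big_nil.
  exact: complex_continuous1.
have -> : (fun z : torus R k => \prod_(i <- j :: s) coordinate z i ^ al 0 i) =
   (fun z => coordinate z j ^ al 0 j * \prod_(i <- s) coordinate z i ^ al 0 i).
  by apply/funext => z; rewrite big_cons.
exact: complex_continuousM.
Qed.

End torus_topology.

(** * Trigonometric polynomials *)

Section trigonometric_polynomials.
Context {R : realType} {k : nat}.
Local Notation C := R[i].
Local Notation exponent := 'rV[int]_k.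
Implicit Types (s t : seq (C * exponent)) (T : set exponent) (F : exponent -> C).

Lemma monomialD al be (z : torus R k) :
  monomial (al + be) z = monomial al z * monomial be z.
Proof.
rewrite /monomial -big_split; apply: eq_bigr => j _.
by rewrite mxE expfzDr// -normr_gt0 norm_coordinate.
Qed.

Lemma monomial0 (z : torus R k) : monomial 0 z = 1.
Proof. by rewrite /monomial big1// => j _; rewrite mxE expr0z. Qed.

Lemma monomialN al (z : torus R k) : monomial (- al) z = (monomial al z)^*%C.
Proof.
have nz : monomial al z != 0 by rewrite -normr_gt0 norm_monomial.
rewrite -unit_norm_inv ?norm_monomial//; apply: (mulIf nz).
by rewrite mulVf// -monomialD addNr monomial0.
Qed.

(* A finite system is given by a list of pairs (coefficient, exponent), in which
   exponents may be repeated, so that sums are concatenations. *)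
Definition lincomb F s : C := \sum_(x <- s) x.1 * F x.2.

Definition tpoly s (z : torus R k) : C := lincomb (fun al => monomial al z) s.

Definition exponents_in T s : Prop := forall x, x \in s -> T x.2.

Lemma lincomb_cat F s t : lincomb F (s ++ t) = lincomb F s + lincomb F t.
Proof. exact: big_cat. Qed.

Lemma lincomb_cons F x s : lincomb F (x :: s) = x.1 * F x.2 + lincomb F s.
Proof. exact: big_cons. Qed.

Lemma lincomb_scale F (c : C) s :
  lincomb F [seq (c * x.1, x.2) | x <- s] = c * lincomb F s.
Proof.
rewrite /lincomb big_map mulr_sumr; apply: eq_bigr => x _.
by rewrite mulrA.
Qed.

Lemma exponents_in_cat T s t :
  exponents_in T s -> exponents_in T t -> exponents_in T (s ++ t).
Proof. by move=> Ts Tt x; rewrite mem_cat => /orP[/Ts|/Tt]. Qed.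

Lemma exponents_in_scale T (c : C) s : exponents_in T s ->
  exponents_in T [seq (c * x.1, x.2) | x <- s].
Proof. by move=> Ts _ /mapP[x /Ts Tx ->]. Qed.

(** [F] is arbitrary, so that one list represents both the polynomial (F al = z^al) and the value of
    the form on it (F al = c al). *)
Lemma lincomb_of_system T (a : exponent -> C) : finite_system T a ->
  exists s, exponents_in T s /\
    forall F, \sum_(al \in T) a al * F al = lincomb F s.
Proof.
move=> /finite_seqP[r rE]; exists [seq (a al, al) | al <- undup r]; split.
  move=> _ /mapP[al + ->] /=; rewrite mem_undup => alr.
  suff [] : [set al | T al /\ a al != 0] al by [].
  by rewrite rE.
move=> F; rewrite /lincomb big_map /= (fsbigE (undup r)) ?undup_uniq//.
- rewrite big_seq_cond [RHS]big_seq; apply: eq_bigl => al.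
  have [alr|//] := boolP (al \in undup r); rewrite /= mem_set//.
  suff [] : [set al | T al /\ a al != 0] al by [].
  by rewrite rE /= -mem_undup.
- move=> al /=; rewrite mem_undup => alr.
  by have : [set` r] al by []; rewrite -rE => -[].
- move=> al Tal; rewrite mem_undup => /negP alr.
  have [->|nz] := eqVneq (a al) 0; first by rewrite mul0r.
  have : [set` r] al by rewrite -rE.
  by move=> /alr.
Qed.

Lemma system_of_lincomb T s : exponents_in T s ->
  exists a : exponent -> C, finite_system T a /\
    forall F, \sum_(al \in T) a al * F al = lincomb F s.
Proof.
move=> Ts; pose a al := \sum_(x <- s | x.2 == al) x.1.
have a0 al : al \notin [seq x.2 | x <- s] -> a al = 0.
  move=> als; rewrite /a big_seq_cond big1// => x /andP[xs /eqP xal].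
  by move: als; rewrite -xal map_f.
exists a; split.
  apply: (@sub_finite_set _ _ [set` [seq x.2 | x <- s]]); last exact: finite_seq.
  move=> al [_]; apply: contra_neqP => /negP; exact: a0.
move=> F; rewrite (fsbigE (undup [seq x.2 | x <- s])) ?undup_uniq//; last 2 first.
- by move=> al /=; rewrite mem_undup => /mapP[x /Ts Tx ->].
- by move=> al _; rewrite mem_undup => /a0->; rewrite mul0r.
transitivity (\sum_(al <- undup [seq x.2 | x <- s]) a al * F al).
  rewrite big_seq_cond [RHS]big_seq; apply: eq_bigl => al.
  rewrite mem_undup; have [/mapP[x /Ts Tx ->]|//] := boolP (_ \in _).
  by rewrite /= mem_set.
under eq_bigr => al _ do rewrite /a big_distrl /=.
rewrite (exchange_big_dep xpredT)//= /lincomb big_seq [RHS]big_seq.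
apply: eq_bigr => x xs; rewrite big_mkcond (bigD1_seq x.2) ?undup_uniq//=; last first.
  by rewrite mem_undup map_f.
by rewrite eqxx big1 ?addr0// => al; rewrite eq_sym => /negbTE->.
Qed.

Lemma trig_sum_tpoly T (a : exponent -> C) s :
  (forall F, \sum_(al \in T) a al * F al = lincomb F s) ->
  forall z : torus R k, trig_sum T a z = tpoly s z.
Proof. by move=> H z; rewrite /trig_sum H. Qed.

Lemma analyticP (p : torus R k -> C) : analytic_trig_poly p <->
  exists2 s, exponents_in (nonneg_index k) s & forall z, p z = tpoly s z.
Proof.
split=> [[a [/lincomb_of_system[s [sN sE]] pE]]|[s /system_of_lincomb[a [fa aE]] pE]].
  by exists s => // z; rewrite pE (trig_sum_tpoly sE).
by exists a; split => // z; rewrite pE (trig_sum_tpoly aE).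
Qed.

Definition is_tpoly (p : torus R k -> C) := exists s, forall z, p z = tpoly s z.

Lemma tpoly_mul s t z :
  tpoly [seq (x.1 * y.1, x.2 + y.2) | x <- s, y <- t] z = tpoly s z * tpoly t z.
Proof.
rewrite /tpoly /lincomb big_allpairs_dep /= mulr_suml; apply: eq_bigr => x _.
rewrite mulr_sumr; apply: eq_bigr => y _.
by rewrite /= monomialD; ring.
Qed.

Lemma tpoly_conj s z :
  tpoly [seq (x.1^*%C, - x.2) | x <- s] z = (tpoly s z)^*%C.
Proof.
rewrite /tpoly /lincomb big_map rmorph_sum; apply: eq_bigr => x _.
by rewrite monomialN -rmorphM.
Qed.

Lemma is_tpolyD p q : is_tpoly p -> is_tpoly q -> is_tpoly (fun z => p z + q z).
Proof.
by move=> [s pE] [t qE]; exists (s ++ t) => z; rewrite /tpoly lincomb_cat pE qE.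
Qed.

Lemma is_tpolyM p q : is_tpoly p -> is_tpoly q -> is_tpoly (fun z => p z * q z).
Proof.
move=> [s pE] [t qE]; exists [seq (x.1 * y.1, x.2 + y.2) | x <- s, y <- t] => z.
by rewrite tpoly_mul pE qE.
Qed.

Lemma is_tpoly_conj p : is_tpoly p -> is_tpoly (fun z => (p z)^*%C).
Proof.
by move=> [s pE]; exists [seq (x.1^*%C, - x.2) | x <- s] => z; rewrite tpoly_conj pE.
Qed.

Lemma is_tpolyN p : is_tpoly p -> is_tpoly (fun z => - p z).
Proof.
move=> [s pE]; exists [seq (-1 * x.1, x.2) | x <- s] => z.
by rewrite /tpoly lincomb_scale mulN1r pE.
Qed.

Lemma is_tpoly_sum (I : Type) (r : seq I) (q : I -> torus R k -> C) :
  (forall j, is_tpoly (q j)) -> is_tpoly (fun z => \sum_(j <- r) q j z).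
Proof.
move=> qT; elim: r => [|j r ih].
  by exists [::] => z; rewrite /tpoly /lincomb !big_nil.
have [s sE] := is_tpolyD (qT j) ih.
by exists s => z; rewrite big_cons sE.
Qed.

Lemma tpoly_shift s : exists be : exponent,
  analytic_trig_poly (fun z => monomial be z * tpoly s z).
Proof.
(* In each coordinate [be] dominates the absolute value of every exponent of [s], so the shifted
   exponents are nonnegative. *)
pose be : exponent := \row_j \sum_(x <- s) `|x.2 0 j|.
exists be; apply/analyticP; exists [seq (x.1, be + x.2) | x <- s].
  move=> _ /mapP[x xs ->] j /=; rewrite !mxE (big_rem x)//= addrAC addr_ge0//.
    by rewrite -lerBlDr sub0r -normrN ler_norm.
  by apply: sumr_ge0.
move=> z; rewrite /tpoly /lincomb mulr_sumr big_map; apply: eq_bigr => x _.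
by rewrite /= monomialD; ring.
Qed.

(** Multiplication by a suitable monomial makes f analytic; since monomials have modulus 1 on the
    torus, it does not change the zeros. *)
Lemma tpoly_determined (Y : set (torus R k)) (f : torus R k -> C) :
  determining Y -> is_tpoly f -> (forall z, Y z -> f z = 0) -> forall z, f z = 0.
Proof.
move=> [_ Ydet] [s fE] fY z; have [be an] := tpoly_shift s.
have := Ydet _ an _ z; rewrite fE => /(_ _)/eqP.
rewrite mulf_eq0 -normr_eq0 norm_monomial oner_eq0 /= => H; apply/eqP/H.
by move=> y Yy; rewrite -fE fY// mulr0.
Qed.

End trigonometric_polynomials.

Section analytic_closure.
Context {R : realType} {k : nat}.
Local Notation C := R[i].
Implicit Types p q : torus R k -> C.

Lemma analytic_cst (c : C) : analytic_trig_poly (fun _ : torus R k => c).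
Proof.
apply/analyticP; exists [:: (c, 0)] => [x|z].
  by rewrite inE => /eqP-> j /=; rewrite mxE.
by rewrite /tpoly /lincomb big_seq1 monomial0 mulr1.
Qed.

Lemma analyticD p q : analytic_trig_poly p -> analytic_trig_poly q ->
  analytic_trig_poly (fun z => p z + q z).
Proof.
move=> /analyticP[s sN pE] /analyticP[t tN qE]; apply/analyticP.
exists (s ++ t); first exact: exponents_in_cat.
by move=> z; rewrite /tpoly lincomb_cat pE qE.
Qed.

Lemma analyticM p q : analytic_trig_poly p -> analytic_trig_poly q ->
  analytic_trig_poly (fun z => p z * q z).
Proof.
move=> /analyticP[s sN pE] /analyticP[t tN qE]; apply/analyticP.
exists [seq (x.1 * y.1, x.2 + y.2) | x <- s, y <- t].
  move=> _ /allpairsP[[x y] [/= xs yt ->]] j /=; rewrite mxE.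
  by rewrite addr_ge0//; [exact: sN|exact: tN].
by move=> z; rewrite tpoly_mul pE qE.
Qed.

Lemma analytic_big (I : Type) (r : seq I) (op : C -> C -> C) (c : C)
    (p : I -> torus R k -> C) :
  (forall f g : torus R k -> C, analytic_trig_poly f -> analytic_trig_poly g ->
     analytic_trig_poly (fun z => op (f z) (g z))) ->
  (forall i, analytic_trig_poly (p i)) ->
  analytic_trig_poly (fun z => \big[op/c]_(i <- r) p i z).
Proof.
move=> opP pP; elim: r => [|i r ih].
  under eq_fun => z do rewrite big_nil; exact: analytic_cst.
under eq_fun => z do rewrite big_cons.
exact: opP.
Qed.

Lemma analytic_coordinate j : analytic_trig_poly (fun z : torus R k => coordinate z j).
Proof.
apply/analyticP; exists [:: (1, delta_mx 0 j)] => [x|z].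
  by rewrite inE => /eqP-> i /=; rewrite mxE eqxx; case: eqP.
rewrite /tpoly /lincomb big_seq1 mul1r /monomial (bigD1 j)//= mxE !eqxx expr1z.
by rewrite big1 ?mulr1// => i /negbTE ij; rewrite mxE ij andbF expr0z.
Qed.

Lemma analyticX p n : analytic_trig_poly p -> analytic_trig_poly (fun z => p z ^+ n).
Proof.
move=> pP; elim: n => [|n ih].
  by under eq_fun => z do rewrite expr0; exact: analytic_cst.
by under eq_fun => z do rewrite exprS; exact: analyticM.
Qed.

End analytic_closure.

(** * Roots of unity and the Fejer kernel in one variable *)

Section roots_of_unity.
Context {R : realType}.
Local Notation C := R[i].

(** X^M - 1 splits over an algebraically closed field and is separable in characteristic 0; its M
    distinct roots include a primitive one. *)
Lemma complex_prim_root M : (0 < M)%N -> exists w : C, M.-primitive_root w.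
Proof.
move=> M0; have [r rE] := closed_field_poly_normal ('X^M - 1 : {poly C}).
rewrite (monicP (monicXnsubC 1 M0)) scale1r in rE.
have runity : all M.-unity_root r.
  by apply/allP => z; rewrite -root_prod_XsubC -rE.
have rsize : (M <= size r)%N.
  by rewrite -ltnS -(size_prod_XsubC r id) -rE size_XnsubC.
have runiq : uniq r.
  by rewrite -separable_prod_XsubC -rE separable_Xn_sub_1// pnatr_eq0 -lt0n.
by have /hasP[w _ wP] := has_prim_root M0 runity runiq rsize; exists w.
Qed.

Variables (M : nat) (w : C).
Hypothesis wP : M.-primitive_root w.

Lemma norm_prim_root : `|w| = 1.
Proof.
have M0 := prim_order_gt0 wP.
by apply/eqP; rewrite -(pexpr_eq1 M0)// -normrX (prim_expr_order wP) normr1.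
Qed.

(** Orthogonality of characters: for 0 < |a| < M the ratio w^a differs from 1, and the geometric sum
    vanishes. *)
Lemma sum_prim_root (a : int) : (`|a| < M)%N ->
  \sum_(v < M) (w ^+ v) ^ a = (a == 0)%:R * M%:R.
Proof.
move=> aM; have [->|a0] := eqVneq a 0.
  under eq_bigr => v _ do rewrite expr0z.
  by rewrite sumr_const card_ord mul1r.
rewrite mul0r.
have -> : \sum_(v < M) (w ^+ v) ^ a = \sum_(v < M) (w ^ a) ^+ v.
  by apply: eq_bigr => v _; rewrite !exprnP !exprz_exp mulrC.
have w1 : w ^ a != 1.
  have nd m : (0 < m < M)%N -> w ^+ m != 1.
    by move=> mM; rewrite -(prim_order_dvd wP) gtnNdvd; lia.
  case: a a0 aM => m a0 aM; first by apply: nd; lia.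
  by rewrite NegzE -exprnN invr_eq1 nd//; lia.
apply: (mulfI (x := w ^ a - 1)); first by rewrite subr_eq0.
rewrite mulr0 -subrX1 exprnP exprz_exp mulrC -exprz_exp.
by rewrite -exprnP (prim_expr_order wP) exp1rz subrr.
Qed.

Lemma sqr_norm_geometric (u : C) N : `|u| = 1 ->
  `|\sum_(n < N) u ^+ n| ^+ 2 = \sum_(n < N) \sum_(m < N) u ^ (n%:Z - m%:Z).
Proof.
move=> u1; have u0 : u != 0 by rewrite -normr_gt0 u1.
rewrite sqr_normc rmorph_sum mulr_suml; apply: eq_bigr => n _.
rewrite mulr_sumr; apply: eq_bigr => m _.
by rewrite rmorphXn /= -unit_norm_inv// expfzDr// exprnP -exprnN exprVn.
Qed.

(** These are the triangular coefficients of the Fejer kernel; truncated subtraction makes the count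
    0 once |a| >= N. *)
Lemma count_differences N (a : int) :
  (\sum_(n < N) \sum_(m < N) (a == n%:Z - m%:Z)%R = N - `|a|)%N.
Proof.
have count_shift d : (\sum_(n < N) \sum_(m < N) (n == m + d :> nat) = N - d)%N.
  rewrite exchange_big /=.
  have -> : (\sum_(m < N) \sum_(n < N) (n == m + d :> nat) =
             \sum_(m < N) (m < N - d))%N.
    apply: eq_bigr => m _; rewrite ltn_subRL [(d + m)%N]addnC.
    have [mdN|mdN] := ltnP (m + d) N; last first.
      rewrite big1 => [//|n _].
      by case: eqP => // nmd; have := ltn_ord n; lia.
    rewrite (bigD1 (Ordinal mdN))//= ?eqxx big1 => [|n /negP nmd].
      by rewrite addn0.
    by case: eqP => // e; exfalso; apply: nmd; apply/eqP/val_inj.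
  have count_lt t K : (\sum_(m < K) (m < t) = minn K t)%N.
    elim: K => [|K ih]; first by rewrite big_ord0 min0n.
    by rewrite big_ord_recr /= ih; lia.
  by rewrite count_lt; lia.
case: a => d.
  rewrite -[RHS]/(N - d)%N -count_shift; apply: eq_bigr => n _; apply: eq_bigr => m _.
  by congr nat_of_bool; lia.
rewrite -[RHS]/(N - d.+1)%N -count_shift exchange_big.
apply: eq_bigr => n _; apply: eq_bigr => m _.
by congr nat_of_bool; lia.
Qed.

(** Expanding the square gives terms (z / w^v)^(n - m), and the sum over v keeps the pairs with n -
    m = a. The bound on M forces |a - (n - m)| < M, which excludes aliasing. *)
Lemma fejer_1d (N : nat) (z : C) (a : int) : `|z| = 1 -> (N + `|a| <= M)%N ->
  \sum_(v < M) (w ^+ v) ^ a * `|\sum_(n < N) (z / w ^+ v) ^+ n| ^+ 2 =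
  M%:R * (N - `|a|)%:R * z ^ a.
Proof.
move=> z1 NM; have z0 : z != 0 by rewrite -normr_gt0 z1.
have wv1 v : `|w ^+ v| = 1 by rewrite normrX norm_prim_root expr1n.
have wv0 v : w ^+ v != 0 by rewrite -normr_gt0 wv1.
transitivity (\sum_(n < N) \sum_(m < N) z ^ (n%:Z - m%:Z) *
    \sum_(v < M) (w ^+ v) ^ (a - (n%:Z - m%:Z))).
  under eq_bigr => v _.
    rewrite sqr_norm_geometric; last by rewrite normrM normfV wv1 z1 divr1.
    rewrite mulr_sumr; over.
  rewrite exchange_big; apply: eq_bigr => n _.
  under eq_bigr => v _ do rewrite mulr_sumr.
  rewrite exchange_big; apply: eq_bigr => m _.
  rewrite mulr_sumr; apply: eq_bigr => v _.
  rewrite expfzMl mulrCA (expfzDr a) //; congr (_ * (_ * _)).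
  by rewrite exprz_inv.
transitivity (\sum_(n < N) \sum_(m < N) (a == n%:Z - m%:Z)%R%:R * (M%:R * z ^ a)).
  apply: eq_bigr => n _; apply: eq_bigr => m _.
  rewrite sum_prim_root; last by have := ltn_ord n; have := ltn_ord m; lia.
  rewrite subr_eq0; case: eqP => [<-|_]; last by rewrite !mul0r mulr0.
  by rewrite !mul1r mulrC.
under eq_bigr => n _ do rewrite -mulr_suml.
rewrite -mulr_suml -count_differences natr_sum mulrA; congr (_ * _).
rewrite mulrC; congr (_ * _).
by apply: eq_bigr => n _; rewrite natr_sum.
Qed.

End roots_of_unity.

(** * Fejer means and sums of squares *)

(** Weierstrass's product inequality; the bounds 0 and 1 on the product carry the induction. *)
Lemma prod_one_minus_bounds (R : realDomainType) (I : Type) (r : seq I) (x : I -> R) :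
  (forall i, 0 <= x i <= 1) ->
  0 <= \prod_(i <- r) (1 - x i) <= 1 /\
  1 - \sum_(i <- r) x i <= \prod_(i <- r) (1 - x i).
Proof.
move=> x01; elim: r => [|i r [/andP[p0 p1] ih]].
  by rewrite !big_nil ler01 lexx subr0.
have /andP[x0 x1] := x01 i; rewrite !big_cons.
set p := \prod_(_ <- _) _ in p0 p1 ih *; set S := \sum_(_ <- _) _ in ih *.
by split; [apply/andP; split; nra|nra].
Qed.

Section fejer.
Context {R : realType} {k : nat}.
Local Notation C := R[i].
Local Notation exponent := 'rV[int]_k.

(** For N > 0, the multiplier of z^al in the Fejer mean of order N: the product of the positive
    parts of 1 - |al_j| / N. *)
Definition fejer_weight (N : nat) (al : exponent) : R :=
  \prod_(j < k) ((N - `|al 0%R j|)%N%:R / N%:R).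

Section grid.
Variables (N M : nat) (w : C).
Hypothesis wP : M.-primitive_root w.

Lemma grid_pointP (f : {ffun 'I_k -> 'I_M}) :
  (\row_j w ^+ f j : 'rV[R[i]^o]_k) \in torus_set R k.
Proof.
by apply: mem_set => j; rewrite mxE normrX (norm_prim_root wP) expr1n.
Qed.

Definition grid_point f : torus R k :=
  exist (fun z => z \in torus_set R k) _ (grid_pointP f).

(** The Dirichlet kernel translated to a grid point, with exponents 0, ..., N - 1 only, which makes
    it analytic. *)
Definition dirichlet (f : {ffun 'I_k -> 'I_M}) (z : torus R k) : C :=
  \prod_(j < k) \sum_(n < N) (coordinate z j / w ^+ f j) ^+ n.

Lemma analytic_dirichlet f : analytic_trig_poly (dirichlet f).
Proof.
apply: analytic_big => [|j]; first exact: analyticM.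
apply: analytic_big => [|n]; first exact: analyticD.
apply: analyticX; apply: analyticM; first exact: analytic_coordinate.
exact: analytic_cst.
Qed.

(** Convolution of z^al with the Fejer kernel as a grid average: [fejer_1d] holds in each
    coordinate, and expanding the product of sums gives a sum over grid points. The factor M^k
    counts these, and N^k normalizes the kernel. *)
Lemma fejer_monomial (al : exponent) (z : torus R k) :
  (forall j, N + `|al 0%R j| <= M)%N ->
  (fejer_weight N al)%:C * monomial al z =
  ((M * N) ^ k)%:R^-1 * \sum_f monomial al (grid_point f) * `|dirichlet f z| ^+ 2.
Proof.
move=> alM; have M0 := prim_order_gt0 wP.
transitivity (((M * N) ^ k)%:R^-1 * \prod_(j < k)
    \sum_(v < M) (w ^+ v) ^ al 0 j *
      `|\sum_(n < N) (coordinate z j / w ^+ v) ^+ n| ^+ 2).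
  rewrite (eq_bigr (fun j => M%:R * (N - `|al 0%R j|)%:R *
      coordinate z j ^ al 0 j)); last first.
    by move=> j _; rewrite (fejer_1d wP)// norm_coordinate.
  rewrite big_split /= mulrA; congr (_ * _).
  rewrite /fejer_weight rmorph_prod natrX -exprVn.
  have -> : (M * N)%:R^-1 ^+ k = \prod_(j < k) (M * N)%:R^-1 :> C.
    by rewrite prodr_const card_ord.
  rewrite -big_split.
  apply: eq_bigr => j _; rewrite /= rmorphM fmorphV !rmorph_nat natrM invfM.
  have M0' : M%:R != 0 :> C by rewrite pnatr_eq0 -lt0n.
  by rewrite mulrACA mulVf// mul1r mulrC.
congr (_ * _); rewrite bigA_distr_bigA; apply: eq_bigr => f _.
rewrite big_split; congr (_ * _).
  by apply: eq_bigr => j _; rewrite /coordinate mxE.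
by rewrite /dirichlet normr_prod prodrXl.
Qed.

End grid.

Lemma fejer_weight0 N : (0 < N)%N -> fejer_weight N 0 = 1.
Proof.
move=> N0; rewrite /fejer_weight big1// => j _.
by rewrite mxE absz0 subn0 divff// pnatr_eq0 -lt0n.
Qed.

Lemma fejer_weight_bounds N (al : exponent) A : (0 < N)%N ->
  (\sum_(j < k) `|al 0%R j| <= A)%N -> (2 * A <= N)%N ->
  1 / 2 <= fejer_weight N al <= 1 /\ 1 - A%:R / N%:R <= fejer_weight N al.
Proof.
move=> N0 sumA AN; have N0' : 0 < N%:R :> R by rewrite ltr0n.
have alA j : (`|al 0%R j| <= A)%N.
  by rewrite (leq_trans _ sumA)// (bigD1 j)//= leq_addr.
have wE : fejer_weight N al = \prod_(j < k) (1 - `|al 0%R j|%:R / N%:R).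
  apply: eq_bigr => j _; rewrite natrB; last by have := alA j; lia.
  by rewrite mulrBl divff// gt_eqF.
have [|/andP[p0 p1] plow] := @prod_one_minus_bounds R _ (index_enum _)
  (fun j : 'I_k => `|al 0%R j|%:R / N%:R).
  move=> j; rewrite divr_ge0//= ler_pdivrMr// mul1r ler_nat.
  by have := alA j; lia.
have low : 1 - A%:R / N%:R <= fejer_weight N al.
  rewrite wE (le_trans _ plow)// lerD2l lerN2 -mulr_suml ler_pM2r ?invr_gt0//.
  by rewrite -natr_sum ler_nat.
split => //; rewrite {2}wE p1 andbT (le_trans _ low)//.
have : A%:R / N%:R <= 1 / 2 :> R.
  by rewrite ler_pdivrMr// mulrAC mul1r ler_pdivlMr// -natrM ler_nat mulnC.
by lra.
Qed.

Lemma Re_scale (a : R) (c : C) : complex.Re (a%:C * c) = a * complex.Re c.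
Proof. by case: c => x y /=; rewrite mul0r subr0. Qed.

Lemma Re_norm_ge0 (c : C) : 0 <= complex.Re `|c|.
Proof. by rewrite normc_def sqrtr_ge0. Qed.

Lemma Re_tpoly_le (s : seq (C * exponent)) (z : torus R k) :
  `|complex.Re (tpoly s z)| <= \sum_(x <- s) complex.Re `|x.1|.
Proof.
rewrite -lecR (le_trans (normc_ge_Re _))// rmorph_sum /=.
rewrite /tpoly /lincomb (le_trans (ler_norm_sum _ _ _))//; apply: ler_sum => x _.
rewrite normrM norm_monomial mulr1 -[leRHS]/((complex.Re `|x.1|)%:C).
by rewrite RRe_real// normr_real.
Qed.

(* The Fejer mean multiplies the coefficients of tpoly s by weights tending to 1.
   Dividing them by the weights first makes the mean equal to tpoly s, and for N
   large this changes the values by at most e. *)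
Lemma nonneg_tpoly_sos (s : seq (C * exponent)) (e : R) :
  (forall z : torus R k, 0 <= tpoly s z) -> 0 < e ->
  exists (m : nat) (q : 'I_m -> torus R k -> C),
    (forall j, analytic_trig_poly (q j)) /\
    forall z, tpoly s z + e%:C = \sum_(j < m) `|q j z| ^+ 2.
Proof.
move=> s_ge0 e0.
pose A := (\sum_(x <- s) \sum_(j < k) `|x.2 0%R j|)%N.
have sA x : x \in s -> (\sum_(j < k) `|x.2 0%R j| <= A)%N.
  by move=> xs; rewrite /A (big_rem x)//= leq_addr.
pose S : R := \sum_(x <- s) complex.Re `|x.1|.
have S0 : 0 <= S.
  by apply: sumr_ge0 => x _; exact: Re_norm_ge0.
(* Division by the weights changes each coefficient by at most 2 A / N times its modulus, hence the
   values by at most 2 A S / N <= e. *)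
have [N [N0 AN SN]] : exists N,
    [/\ (0 < N)%N, (2 * A <= N)%N & 2 * A%:R * S <= e * N%:R].
  have b0 : 0 <= 2 * A%:R * S / e by rewrite divr_ge0 ?mulr_ge0// ltW.
  exists (Num.bound (2 * A%:R * S / e) + 2 * A).+1; split => //.
    by rewrite -addnS -addSnnS leq_addl.
  rewrite [leRHS]mulrC -ler_pdivrMr//.
  rewrite (le_trans (ltW (archi_boundP b0)))// ler_nat.
  by rewrite -addnS leq_addr.
have N0' : 0 < N%:R :> R by rewrite ltr0n.
(* The order 2 N is large enough for [fejer_monomial], as the entries of the exponents are at most A
   <= N in modulus. *)
have [w wP] := @complex_prim_root R (2 * N) ltac:(lia).
set u := fejer_weight N.
(* The Fejer mean of [h] is tpoly s + e, the weight of the exponent 0 being 1. *)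
pose h := (e%:C, 0) :: [seq (x.1 * ((u x.2)^-1)%:C, x.2) | x <- s].
have uP x : x \in s ->
    [/\ 0 < u x.2, 1 / 2 <= u x.2, u x.2 <= 1 & 1 - A%:R / N%:R <= u x.2].
  move=> /sA xA; have [/andP[u1 u2] u3] := fejer_weight_bounds N0 xA AN.
  by split => //; apply: lt_le_trans u1; lra.
have h_ge0 z : 0 <= complex.Re (tpoly h z).
  have hE : tpoly h z = tpoly s z + e%:C +
      tpoly [seq (x.1 * ((u x.2)^-1 - 1)%:C, x.2) | x <- s] z.
    rewrite /tpoly lincomb_cons monomial0 mulr1 addrAC addrC; congr (_ + _).
    rewrite /lincomb !big_map -big_split; apply: eq_bigr => x _ /=.
    by rewrite rmorphB rmorph1; ring.
  have err := Re_tpoly_le [seq (x.1 * ((u x.2)^-1 - 1)%:C, x.2) | x <- s] z.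
  have errS : \sum_(x <- [seq (x.1 * ((u x.2)^-1 - 1)%:C, x.2) | x <- s])
      complex.Re `|x.1| <= e.
    rewrite big_map /=.
    apply: (@le_trans _ _ (2 * A%:R / N%:R * S)); last first.
      by rewrite mulrAC ler_pdivrMr.
    rewrite /S mulr_sumr big_seq [leRHS]big_seq; apply: ler_sum => x xs.
    have [u0 u1 u2 u3] := uP x xs.
    have v0 : 0 <= (u x.2)^-1 - 1 by rewrite subr_ge0 invf_ge1.
    rewrite -[leLHS]/(complex.Re `|x.1 * ((u x.2)^-1 - 1)%:C|).
    rewrite normrM [X in _ * X]ger0_norm ?lecR// mulrC Re_scale.
    rewrite ler_wpM2r//; first exact: Re_norm_ge0.
    have -> : (u x.2)^-1 - 1 = (u x.2)^-1 * (1 - u x.2).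
      by rewrite mulrBr mulVf ?gt_eqF// mulr1.
    rewrite -mulrA ler_pM ?invr_ge0 ?(ltW u0) ?subr_ge0//; last by lra.
    by rewrite -[leRHS]invrK lef_pV2 ?posrE ?invr_gt0// -div1r.
  have := s_ge0 z; rewrite lecE => /andP[_ /= p0].
  rewrite hE !raddfD /=.
  move: err; rewrite ler_norml => /andP[err _].
  lra.
pose kappa : R := ((2 * N * N) ^ k)%:R^-1.
have kappa0 : 0 <= kappa by rewrite invr_ge0.
have key z : tpoly s z + e%:C = (\sum_f kappa * complex.Re (tpoly h (grid_point wP f)) *
    complex.Re (`|dirichlet N w f z| ^+ 2))%:C.
  have idn : tpoly s z + e%:C =
      kappa%:C * \sum_f tpoly h (grid_point wP f) *
        (complex.Re (`|dirichlet N w f z| ^+ 2))%:C.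
    transitivity (\sum_(x <- h) x.1 * ((u x.2)%:C * monomial x.2 z)).
      rewrite /h big_cons /u fejer_weight0// mul1r monomial0 mulr1 addrC; congr (_ + _).
      rewrite big_map /tpoly /lincomb big_seq [RHS]big_seq.
      apply: eq_bigr => x /uP[u0 _ _ _] /=.
      by rewrite mulrA -(mulrA x.1) -rmorphM mulVf ?gt_eqF// mulr1.
    have -> : \sum_f tpoly h (grid_point wP f) *
          (complex.Re (`|dirichlet N w f z| ^+ 2))%:C =
        \sum_(x <- h) x.1 * \sum_f monomial x.2 (grid_point wP f) *
          `|dirichlet N w f z| ^+ 2.
      under eq_bigr => f _ do rewrite /tpoly /lincomb mulr_suml.
      rewrite exchange_big; apply: eq_bigr => x _; rewrite mulr_sumr.
      apply: eq_bigr => f _; rewrite mulrA; congr (_ * _).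
      by rewrite RRe_real// ger0_real// exprn_ge0.
    rewrite mulr_sumr big_seq [RHS]big_seq; apply: eq_bigr => x xh.
    rewrite [RHS]mulrCA /kappa fmorphV rmorph_nat; congr (_ * _).
    apply: fejer_monomial => // j.
    move: xh; rewrite inE => /orP[/eqP->|/mapP[y ys ->]] /=.
      by rewrite mxE; lia.
    have := sA _ ys; rewrite (bigD1 j)//=; lia.
  (* The left side is real, so real parts can be taken on the right, where only the real part of [h]
     at the grid points then enters. *)
  rewrite -[LHS]RRe_real; last first.
    by apply: ger0_real; apply: addr_ge0; [exact: s_ge0|rewrite ler0c ltW].
  rewrite idn Re_scale raddf_sum mulr_sumr; congr (_%:C); apply: eq_bigr => f _.
  rewrite -mulrA; congr (_ * _); rewrite [in LHS]mulrC.
  exact: etrans (Re_scale _ _) (mulrC _ _).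
exists #|{ffun 'I_k -> 'I_(2 * N)}|.
exists (fun j z =>
  (Num.sqrt (kappa * complex.Re (tpoly h (grid_point wP (enum_val j)))))%:C *
  dirichlet N w (enum_val j) z).
split.
  by move=> j; apply: analyticM; [exact: analytic_cst|exact: analytic_dirichlet].
move=> z; rewrite key rmorph_sum (reindex (@enum_val _ predT)); last first.
  exact/onW_bij/enum_val_bij.
apply: eq_bigr => j _.
rewrite normrM exprMn rmorphM; congr (_ * _).
  rewrite ger0_norm ?lecR ?sqrtr_ge0// -rmorphXn /= sqr_sqrtr//.
  by rewrite mulr_ge0.
by apply: RRe_real; apply: ger0_real; apply: exprn_ge0.
Qed.

End fejer.

(** * Moments *)

Section moments.
Context {R : realType} {k : nat}.
Local Notation C := R[i].
Local Notation exponent := 'rV[int]_k.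
Implicit Types (f g : torus R k -> C) (s : seq (C * exponent)) (T : set exponent).

Definition bounded_continuous f := [/\ complex_continuous f,
  real_bounded (fun z => complex.Re (f z)) & real_bounded (fun z => complex.Im (f z))].

Lemma continuous_lin (t : R) (f g : torus R k -> R) : continuous f ->
  continuous g -> continuous (fun z => t * f z + g z).
Proof.
move=> fc gc z; have ct : continuous (fun _ : torus R k => t) by exact: cst_continuous.
exact: (cvgD (cvgM (ct z) (fc z)) (gc z)).
Qed.

(** The right side is nested so that real linearity in the shape t f + g applies twice. *)
Lemma Re_lin (a x y : C) : complex.Re (a * x + y) =
  complex.Re a * complex.Re x + (- complex.Im a * complex.Im x + complex.Re y).
Proof. by case: a x y => ? ? [? ?] [? ?] /=; ring. Qed.

Lemma Im_lin (a x y : C) : complex.Im (a * x + y) =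
  complex.Re a * complex.Im x + (complex.Im a * complex.Re x + complex.Im y).
Proof. by case: a x y => ? ? [? ?] [? ?] /=; ring. Qed.

Lemma bounded_continuous_lin (a : C) f g : bounded_continuous f ->
  bounded_continuous g -> bounded_continuous (fun z => a * f z + g z).
Proof.
move=> [[fr fi] bfr bfi] [[gr gi] bgr bgi].
rewrite /bounded_continuous /complex_continuous.
rewrite (_ : (fun z => complex.Re (a * f z + g z)) =
  fun z => complex.Re a * complex.Re (f z) +
  (- complex.Im a * complex.Im (f z) + complex.Re (g z))); last first.
  by apply/funext => z; exact: Re_lin.
rewrite (_ : (fun z => complex.Im (a * f z + g z)) =
  fun z => complex.Re a * complex.Im (f z) +
  (complex.Im a * complex.Re (f z) + complex.Im (g z))); last first.
  by apply/funext => z; exact: Im_lin.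
by split; [split; do 2?apply: continuous_lin|do 2?apply: real_bounded_lin|
  do 2?apply: real_bounded_lin].
Qed.

Lemma bounded_continuous_monomial al : bounded_continuous (monomial al).
Proof.
split; first exact: complex_continuous_monomial.
  by exists 1 => z; rewrite -lecR (le_trans (normc_ge_Re _))// norm_monomial.
by exists 1 => z; rewrite -lecR (le_trans (normc_ge_Im _))// norm_monomial.
Qed.

Lemma bounded_continuous0 : bounded_continuous (fun=> 0).
Proof.
by split; [split; exact: cst_continuous|exact: real_bounded_cst|
  exact: real_bounded_cst].
Qed.

Lemma bounded_continuous_tpoly s : bounded_continuous (tpoly s).
Proof.
elim: s => [|x s ih].
  under [tpoly _]eq_fun => z do rewrite /tpoly /lincomb big_nil.
  exact: bounded_continuous0.
under [tpoly _]eq_fun => z do rewrite /tpoly lincomb_cons.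
by apply: bounded_continuous_lin => //; exact: bounded_continuous_monomial.
Qed.

Variable mu : {finite_measure set (borel_torus R k) -> \bar R}.

Lemma complex_integral_lin (a : C) f g : bounded_continuous f ->
  bounded_continuous g ->
  complex_integral mu (fun z => a * f z + g z) =
  a * complex_integral mu f + complex_integral mu g.
Proof.
move=> [[fr fi] bfr bfi] [[gr gi] bgr bgi].
apply/eqP; rewrite eq_complex Re_lin Im_lin /=.
have mc (h : torus R k -> R) := @continuous_borel_measurable R (torus R k) h.
have El (p q r : torus R k -> R) (t u : R) :
    continuous p -> real_bounded p -> continuous q -> real_bounded q ->
    continuous r -> real_bounded r ->
    \int[mu]_z (t * p z + (u * q z + r z)) =
    t * \int[mu]_z p z + (u * \int[mu]_z q z + \int[mu]_z r z).
  move=> cp bp cq bq cr br.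
  rewrite (@Rintegral_lin R (torus R k) mu t p (fun z => u * q z + r z)) //.
  - by rewrite (@Rintegral_lin R (torus R k) mu u q r) //; exact: mc.
  - exact: mc.
  - by apply: mc; exact: continuous_lin.
  - exact: real_bounded_lin.
by apply/andP; split; apply/eqP; (rewrite -El//; congr Rintegral; apply/funext => z;
  [exact: Re_lin || exact: Im_lin]).
Qed.

Lemma complex_integral_tpoly s :
  complex_integral mu (tpoly s) =
  lincomb (fun al => complex_integral mu (monomial al)) s.
Proof.
elim: s => [|x s ih].
  rewrite /lincomb big_nil /complex_integral /tpoly /lincomb.
  under eq_Rintegral do rewrite big_nil.
  under [X in _ +i* X]eq_Rintegral do rewrite big_nil.
  by rewrite !Rintegral_cst//= !mul0r.
rewrite lincomb_cons -ih -complex_integral_lin.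
- by congr complex_integral; apply/funext => z; rewrite /tpoly lincomb_cons.
- exact: bounded_continuous_monomial.
- exact: bounded_continuous_tpoly.
Qed.

Lemma complex_integral_ge0 f : (forall z, 0 <= f z) -> 0 <= complex_integral mu f.
Proof.
move=> f0; rewrite lecE /=; apply/andP; split; last first.
  by apply: Rintegral_ge0 => z _; have := f0 z; rewrite lecE => /andP[].
under eq_Rintegral => z _ do rewrite ger0_Im//.
by rewrite Rintegral_cst//= mul0r.
Qed.

End moments.

(** * The representing measure of a positive form *)

Section positive_linear_form.
Context {R : realType} {k : nat}.
Local Notation C := R[i].
Local Notation exponent := 'rV[int]_k.
Variables (T : set exponent) (c : exponent -> C).
Hypothesis k_gt0 : (0 < k)%N.
Hypothesis T0 : T 0.
Hypothesis TN : forall al, T al -> T (- al).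
Hypothesis c_ge0 : forall s, exponents_in T s ->
  (forall z : torus R k, 0 <= tpoly s z) -> 0 <= lincomb c s.

Let c00 : 0 <= c 0.
Proof.
have := @c_ge0 [:: (1, 0)]; rewrite /tpoly /lincomb big_seq1 mul1r; apply.
  by move=> x; rewrite inE => /eqP->.
by move=> z; rewrite big_seq1 monomial0 mul1r ler01.
Qed.

(** As 1 + f >= 0, the number c 0 + lincomb c s is nonnegative and hence real, and so is c 0. *)
Let lincomb_real s (f : torus R k -> R) : exponents_in T s ->
  (forall z, tpoly s z = (f z)%:C) -> (forall z, `|f z| <= 1) ->
  lincomb c s = (complex.Re (lincomb c s))%:C.
Proof.
move=> sT sE f1.
have : 0 <= lincomb c ((1, 0) :: s).
  apply: c_ge0 => [x|z]; first by rewrite inE => /orP[/eqP->|/sT].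
  rewrite /tpoly lincomb_cons monomial0 mul1r -/(tpoly s z) sE.
  rewrite -[1]/(1%:C) -rmorphD ler0c.
  by have := f1 z; rewrite ler_norml => /andP[]; lra.
rewrite lincomb_cons mul1r => cs0; rewrite RRe_real//.
have -> : lincomb c s = c 0 + lincomb c s - c 0 by ring.
by apply: realB; exact: ger0_real.
Qed.

Lemma measure_of_positive_form :
  exists mu : {finite_measure set (borel_torus R k) -> \bar R},
    forall al, T al -> c al = complex_integral mu (monomial al).
Proof.
(* The graph of the form on the real-valued polynomials with exponents in [T]; positivity will make
   it single-valued. *)
pose G := [set p : (torus R k -> R) * R | exists s, [/\ exponents_in T s,
  forall z, tpoly s z = (p.1 z)%:C & lincomb c s = (p.2)%:C]].
have Glin : linear_graph G.
  move=> t p q [s [sT sE sc]] [s' [s'T s'E s'c]].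
  exists ([seq (t%:C * x.1, x.2) | x <- s] ++ s'); split.
  - by apply: exponents_in_cat => //; exact: exponents_in_scale.
  - move=> z; rewrite /tpoly lincomb_cat lincomb_scale -!/(tpoly _ _) sE s'E.
    by rewrite rmorphD rmorphM.
  - by rewrite lincomb_cat lincomb_scale sc s'c rmorphD rmorphM.
have Gpos : positive_graph G.
  move=> p [s [sT sE sc]] p0; rewrite -ler0c -sc; apply: c_ge0 => // z.
  by rewrite sE ler0c.
have G1 : G (fun=> 1, complex.Re (c 0)).
  exists [:: (1, 0)]; split.
  - by move=> x; rewrite inE => /eqP->.
  - by move=> z; rewrite /tpoly /lincomb big_seq1 monomial0 mul1r.
  - by rewrite /lincomb big_seq1 mul1r /= RRe_real// ger0_real.
have [L [LG Llin Lpos]] := positive_extension Glin Gpos G1.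
have [mu muL] :=
  positive_functional_measure torus_compact (torus_cozero k_gt0) Llin Lpos.
exists mu => al Tal.
have [[mr mi] br bi] := @bounded_continuous_monomial R k al.
have re1 z : `|complex.Re (monomial al z : C)| <= 1.
  by rewrite -lecR (le_trans (normc_ge_Re _))// norm_monomial.
have im1 z : `|complex.Im (monomial al z : C)| <= 1.
  by rewrite -lecR (le_trans (normc_ge_Im _))// norm_monomial.
(* Re z^al = (z^al + z^-al) / 2 and Im z^al = i (z^-al - z^al) / 2 have exponents in [T], by T =
   -T. *)
pose h : R := 2^-1.
pose sr : seq (C * exponent) := [:: (h%:C, al); (h%:C, - al)].
pose si : seq (C * exponent) := [:: ((- h) *i, al); (h *i, - al)].
have inT (x y : C) : exponents_in T [:: (x, al); (y, - al)].
  by move=> p; rewrite !inE => /orP[/eqP->|/eqP->] //=; exact: TN.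
have srE z : tpoly sr z = (complex.Re (monomial al z : C))%:C.
  rewrite /tpoly /lincomb big_cons big_seq1 /= monomialN /h.
  case: (monomial al z) => a b; apply/eqP; rewrite eq_complex /=.
  by apply/andP; split; apply/eqP; field.
have siE z : tpoly si z = (complex.Im (monomial al z : C))%:C.
  rewrite /tpoly /lincomb big_cons big_seq1 /= monomialN /h.
  case: (monomial al z) => a b; apply/eqP; rewrite eq_complex /=.
  by apply/andP; split; apply/eqP; field.
have Lr : \int[mu]_z complex.Re (monomial al z) = complex.Re (lincomb c sr).
  rewrite (muL _ mr br); apply: LG => //; exists sr; split => //.
    exact: inT.
  by apply: (lincomb_real _ srE re1); exact: inT.
have Li : \int[mu]_z complex.Im (monomial al z) = complex.Re (lincomb c si).
  rewrite (muL _ mi bi); apply: LG => //; exists si; split => //.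
    exact: inT.
  by apply: (lincomb_real _ siE im1); exact: inT.
(* The values of the form at [sr] and [si] recombine to c al, as z^al = Re z^al + i Im z^al. *)
rewrite /complex_integral Lr Li [RHS]complexE /= -(lincomb_real _ srE re1);
  last exact: inT.
rewrite -(lincomb_real _ siE im1); last exact: inT.
rewrite /lincomb !big_cons !big_nil /= /h.
case: (c al) (c (- al)) => a b [d e].
by apply/eqP; rewrite eq_complex /=; apply/andP; split; apply/eqP; field.
Qed.

End positive_linear_form.

(** * Equivalence of the three conditions *)

Theorem theorem34 (R : realType) (k : nat) (k_gt0 : (0 < k)%N)
  (T : set 'rV[int]_k) (T0 : T 0) (TN : [set - al | al in T] = T)
  (Y : set (torus R k)) (Ydet : determining Y)
  (c : 'rV[int]_k -> R[i]) :
  let moment :=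
    exists mu : {finite_measure set (borel_torus R k) -> \bar R},
      forall al, T al -> c al = complex_integral mu (monomial al) in
  let nonneg_on_torus :=
    forall a : 'rV[int]_k -> R[i], finite_system T a ->
      (forall z : torus R k, 0 <= trig_sum T a z) ->
      0 <= \sum_(al \in T) a al * c al in
  let nonneg_on_sos :=
    forall a : 'rV[int]_k -> R[i], finite_system T a ->
      (exists (m : nat) (q : 'I_m -> torus R k -> R[i]),
        (forall j, analytic_trig_poly (q j)) /\
        (forall z, Y z -> trig_sum T a z = \sum_(j < m) `|q j z| ^+ 2)) ->
      0 <= \sum_(al \in T) a al * c al in
  (moment <-> nonneg_on_torus) /\ (nonneg_on_torus <-> nonneg_on_sos).
Proof.
have TNE al : T al -> T (- al) by move=> Tal; rewrite -TN; exists al.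
move=> moment nonneg_on_torus nonneg_on_sos; split; split.
- move=> [mu muc] a /lincomb_of_system[s [sT sE]] a0; rewrite sE.
  (* By the moment identities, the value of the form at a polynomial is its integral. *)
  have -> : lincomb c s = complex_integral mu (tpoly s).
    rewrite complex_integral_tpoly /lincomb big_seq [RHS]big_seq.
    by apply: eq_bigr => x /sT /muc->.
  by apply: complex_integral_ge0 => z; rewrite -(trig_sum_tpoly sE).
- move=> pos; apply: measure_of_positive_form => // s /system_of_lincomb[a [fa aE]] s0.
  by rewrite -aE; apply: pos => // z; rewrite (trig_sum_tpoly aE).
- move=> pos a fa [m [q [qan qE]]]; apply: pos => // z.
  suff -> : trig_sum T a z = \sum_(j < m) `|q j z| ^+ 2.
    by apply: sumr_ge0 => j _; exact: exprn_ge0.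
  (* The difference of the two sides is a trigonometric polynomial, as |q|^2 is q times its
     conjugate, and it vanishes on [Y]. *)
  apply/eqP; rewrite -subr_eq0; apply/eqP; move: z.
  apply: (tpoly_determined Ydet); last by move=> z Yz; rewrite qE// subrr.
  apply: is_tpolyD.
    by have [s [_ sE]] := lincomb_of_system fa; exists s; exact: trig_sum_tpoly.
  apply: is_tpolyN; apply: is_tpoly_sum => j.
  have /analyticP[s _ sE] := qan j.
  have qT : is_tpoly (q j) by exists s.
  have [t tE] := is_tpolyM qT (is_tpoly_conj qT).
  by exists t => z; rewrite sqr_normc tE.
- move=> pos a /lincomb_of_system[s [sT sE]] a0; rewrite sE.
  have s0 z : 0 <= tpoly s z by rewrite -(trig_sum_tpoly sE).
  have pos' t : exponents_in T t -> (exists (m : nat) (q : 'I_m -> torus R k -> R[i]),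
      (forall j, analytic_trig_poly (q j)) /\
      forall z, tpoly t z = \sum_(j < m) `|q j z| ^+ 2) -> 0 <= lincomb c t.
    move=> /system_of_lincomb[b [fb bE]] [m [q [qan qE]]]; rewrite -bE.
    apply: pos => //; exists m, q; split => // z _.
    by rewrite (trig_sum_tpoly bE).
  have c0 : 0 <= c 0.
    have -> : c 0 = lincomb c [:: (1, 0)] by rewrite /lincomb big_seq1 mul1r.
    apply: pos' => [x|]; first by rewrite inE => /eqP->.
    exists 1%N, (fun _ _ => 1); split => [j|z]; first exact: analytic_cst.
    by rewrite /tpoly /lincomb big_seq1 big_ord1 monomial0 mulr1 normr1 expr1n.
  (* The polynomial tpoly s + e is a sum of squares, and this is the value of the form at it; e will
     then tend to 0. *)
  have eps e : 0 < e -> 0 <= e%:C * c 0 + lincomb c s.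
    move=> e0; rewrite -(lincomb_cons c (e%:C, 0)); apply: pos' => [x|].
      by rewrite inE => /orP[/eqP->//|/sT].
    have [m [q [qan qE]]] := nonneg_tpoly_sos s0 e0.
    exists m, q; split => // z.
    by rewrite -qE /tpoly lincomb_cons monomial0 mulr1 addrC.
  move: c0 eps; case: (c 0) (lincomb c s) => x y [u v].
  rewrite lecE /= => /andP[/eqP-> x0] eps.
  rewrite lecE /=; apply/andP; split.
    (* As c 0 is real, the case e = 1 already shows that [lincomb c s] has imaginary part 0. *)
    have := eps 1 ltr01; rewrite lecE /= => /andP[/eqP + _] => /eqP.
    by rewrite mulr0 mul0r !add0r.
  apply/ler_addgt0Pr => e e0.
  (* The product of this number with x = c 0 is at most e; the summand 1 covers x = 0. *)
  have d0 : 0 < e / (x + 1) by rewrite divr_gt0// ltr_wpDl.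
  have := eps _ d0; rewrite lecE /= => /andP[_].
  rewrite mul0r subr0 addrC => /le_trans; apply; rewrite lerD2l.
  by rewrite mulrAC ler_pdivrMr ?ltr_wpDl// ler_pM2l// lerDl.
Qed.
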